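(* Let $p:\mathbb{N}\to(0,1)$ be a function satisfying $N^{-1}=o(p(N))$ and $p(N)=o(1)$ as $N\to\infty$. Let $u,v$ be non-zero integers with $u\ge|v|$, $\gcd(u,v)=1$ and $(u,v)\ne(1,1)$. Put $f(x,y):=ux+vy$. For a positive integer $N$, let $A$ be a random subset of $I_N=\{0,1,\dots,N\}$ obtained by choosing each $n\in I_N$ independently with probability $p(N)$. Let $\mathscr{D}_f$ denote the random variable $|f(A)|$, where $f(A)=\{ua_1+va_2:a_1,a_2\in A\}$. Then the following three situations arise. (i) If $p(N)=o(N^{-1/2})$, then $\mathscr{D}_f\sim (N\cdot p(N))^2$. (ii) If $p(N)=c\cdot N^{-1/2}$ for some $c\in(0,\infty)$, define $g_{u,v}:(0,\infty)\to(0,u+|v|)$ by $$g_{u,v}(x):=(u+|v|)-2|v|\left(\frac{1-e^{-x}}{x}\right)-(u-|v|)e^{-x}.$$ Then $$\mathscr{D}_f\sim g_{u,v}\left(\frac{c^2}{u}\right)N.$$ (iii) If $N^{-1/2}=o(p(N))$, let $\mathscr{D}_f^c:=(u+|v|)N-\mathscr{D}_f$. Then $$\mathscr{D}_f^c\sim\frac{2u|v|}{p(N)^2}.$$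
   Context: For a real-valued random variable $X$ depending on $N$ and a real-valued function $F(N)$, $X\sim F(N)$ means: for all $\epsilon_1,\epsilon_2>0$ there is $N_{\epsilon_1,\epsilon_2}>0$ such that for all $N>N_{\epsilon_1,\epsilon_2}$, $\mathbb{P}\bigl(X\notin[(1-\epsilon_1)F(N),(1+\epsilon_1)F(N)]\bigr)<\epsilon_2$. $f=o(g)$ means $\lim_{N\to\infty}f(N)/g(N)=0$. $|\cdot|$ of a set denotes its cardinality. *)

(* Defs.v *)
From HB Require Import structures.
From mathcomp Require Import all_boot all_order all_algebra finmap.
From mathcomp Require Import all_classical all_reals all_analysis.

Set Implicit Arguments.
Unset Strict Implicit.
Unset Printing Implicit Defensive.

Import Order.TTheory GRing.Theory Num.Theory.
Import numFieldNormedType.Exports.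
Local Open Scope ring_scope.

Definition is_little_o (R : realType) (f g : nat -> R) : Prop :=
  ((fun N => f N / g N) @ \oo --> (0 : R))%classic.

(* I_N = {0, ..., N} is the type 'I_N.+1.  The mass of A is the probability
   that A is the outcome when each n in I_N is chosen independently with
   probability q. *)
Definition bernoulli_mass (R : realType) (q : R) (N : nat)
    (A : {set 'I_N.+1}) : R :=
  \prod_(n < N.+1) (if n \in A then q else 1 - q).

Definition Pr (R : realType) (q : R) (N : nat)
    (E : {set {set 'I_N.+1}}) : R :=
  \sum_(A in E) bernoulli_mass q A.

(* X N is a random variable on the space of subsets of I_N, each element being
   chosen with probability p N. *)
Definition prob_sim (R : realType) (p : nat -> R)
    (X : forall N : nat, {set 'I_N.+1} -> R) (F : nat -> R) : Prop :=
  forall e1 e2 : R, 0 < e1 -> 0 < e2 ->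
  exists2 N0 : nat, (0 < N0)%N &
    forall N : nat, (N0 < N)%N ->
      Pr (p N) [set A : {set 'I_N.+1} |
                 X N A \notin `[(1 - e1) * F N, (1 + e1) * F N]] < e2.

Definition linform (u v x y : int) : int := u * x + v * y.

Definition form_image (f : int -> int -> int) (N : nat) (A : {set 'I_N.+1}) :
    {fset int} :=
  [fset f (a1 : nat)%:Z (a2 : nat)%:Z |
    a1 : 'I_N.+1 in A, a2 : 'I_N.+1 in A]%fset.

Definition image_card (R : realType) (f : int -> int -> int) (N : nat)
    (A : {set 'I_N.+1}) : R :=
  (#|` form_image f A|)%:R.

Definition image_cocard (R : realType) (u v : int) (N : nat)
    (A : {set 'I_N.+1}) : R :=
  (u + `|v|)%:~R * N%:R - image_card R (linform u v) A.

Definition g (R : realType) (u v : int) (x : R) : R :=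
  (u + `|v|)%:~R - 2 * `|v|%:~R * ((1 - expR (- x)) / x)
  - (u - `|v|)%:~R * expR (- x).

Lemma Pr_setT (R : realType) (q : R) (N : nat) :
  Pr q [set: {set 'I_N.+1}] = 1.
Proof.
rewrite /Pr /bernoulli_mass.
transitivity (\prod_(n < N.+1) (q + (1 - q))); last first.
  by rewrite big1 // => n _; rewrite addrC subrK.
rewrite bigA_distr /=; apply: eq_big => // A; first by rewrite inE.
Qed.

(* With S ranging over all subsets of I_N this says that the events n \in A
   are mutually independent, each of probability q. *)
Lemma Pr_superset (R : realType) (q : R) (N : nat) (S : {set 'I_N.+1}) :
  Pr q [set A : {set 'I_N.+1} | S \subset A] = q ^+ #|S|.
Proof.
rewrite /Pr /bernoulli_mass.
transitivity (\prod_(n < N.+1) (q + (if n \in S then 0 else 1 - q))).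
  rewrite bigA_distr /= big_mkcond /=; apply: eq_bigr => A _; rewrite inE.
  case: ifPn => [/fintype.subsetP SA|/fintype.subsetPn[n nS nA]].
    apply: eq_bigr => n _; case: ifPn => // nA.
    by case: ifPn => // /SA; rewrite (negbTE nA).
  by rewrite (bigD1 n) //= (negbTE nA) nS mul0r.
rewrite (bigID (mem S)) /= [X in _ * X]big1 ?mulr1; last first.
  by move=> n /negbTE ->; rewrite addrC subrK.
rewrite -prodr_const; apply: eq_bigr => n ->; by rewrite addr0.
Qed.

(* Main.v *)
Require Import Defs.
From HB Require Import structures.
From mathcomp Require Import all_boot all_order all_algebra finmap.
From mathcomp Require Import all_classical all_reals all_analysis.
From mathcomp Require Import zify ring lra.

Set Implicit Arguments.
Unset Strict Implicit.
Unset Printing Implicit Defensive.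

Import Order.TTheory GRing.Theory Num.Theory.
Import numFieldNormedType.Exports.
Local Open Scope ring_scope.

(** The number M of values k missing from f(A) is a sum of indicators: k is
    missing iff A is an independent set of the graph whose edges {x, y} are the
    solutions of u x + v y = k.  Such a graph, and the union of two of them, has
    bounded degree; removing a vertex together with its neighbours shows, by
    induction on the number r of edges, that A is independent with probability
    exp (- p^2 r (1 + O(p))).  Distinct values k and l have disjoint edge sets
    up to O(1) edges (except k and -k when u + v = 0), so E M^2 is
    asymptotically at most (E M)^2 and Chebyshev's inequality applies.  Since
    r(k) is within O(1) of a trapezoidal function of k, E M is asymptotically a
    sum of geometric progressions, and p^2 E M converges both when p^2 N is
    constant and when it tends to infinity.

    If p = o(N^(-1/2)), almost all pairs give distinct values: with n = |A| and
    C the number of coincidences f(x, y) = f(x', y') between off-diagonal pairs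
    of A, one has n^2 - n - C <= |f(A)| <= n^2 and E C = o((N p)^2). *)

(** * Expectation of functions of the random set *)

Section Expectation.
Variables (R : realType) (q : R) (N : nat).
Implicit Types (F G : {set 'I_N.+1} -> R) (x : 'I_N.+1).

Definition Ex F : R := \sum_A bernoulli_mass q A * F A.

Lemma eq_Ex F G : F =1 G -> Ex F = Ex G.
Proof. by move=> FG; apply: eq_bigr => A _; rewrite FG. Qed.

Lemma ExD F G : Ex (fun A => F A + G A) = Ex F + Ex G.
Proof. by rewrite -big_split; apply: eq_bigr => A _ /=; rewrite mulrDr. Qed.

Lemma ExZ (c : R) F : Ex (fun A => c * F A) = c * Ex F.
Proof. by rewrite mulr_sumr; apply: eq_bigr => A _; rewrite mulrCA. Qed.

Lemma Ex_sum (I : finType) (P : pred I) (F : I -> {set 'I_N.+1} -> R) :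
  Ex (fun A => \sum_(i | P i) F i A) = \sum_(i | P i) Ex (F i).
Proof.
by rewrite exchange_big; apply: eq_bigr => A _ /=; rewrite mulr_sumr.
Qed.

Lemma PrE (E : {set {set 'I_N.+1}}) : Pr q E = Ex (fun A => (A \in E)%:R).
Proof.
rewrite /Pr big_mkcond; apply: eq_bigr => A _.
by case: (A \in E); rewrite ?mulr1 ?mulr0.
Qed.

Lemma Ex_cst (c : R) : Ex (fun=> c) = c.
Proof.
rewrite -[RHS]mulr1 -(Pr_setT q N) PrE -ExZ.
by apply: eq_Ex => A; rewrite inE mulr1.
Qed.

Lemma Ex_superset (S : {set 'I_N.+1}) :
  Ex (fun A => (S \subset A)%:R) = q ^+ #|S|.
Proof. by rewrite -Pr_superset PrE; apply: eq_Ex => A; rewrite inE. Qed.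

Lemma Ex_split x F :
  Ex F = \sum_(A : {set 'I_N.+1} | x \notin A)
    (\prod_(n < N.+1 | n != x) (if n \in A then q else 1 - q)) *
    ((1 - q) * F A + q * F (x |: A)).
Proof.
rewrite /Ex (bigID (fun A : {set 'I_N.+1} => x \notin A)) /=.
rewrite [X in _ + X](reindex_onto (fun A => x |: A) (fun A => A :\ x)) /=;
  last first.
  by move=> A; rewrite negbK => xA; rewrite finset.setD1K.
rewrite [X in _ + X](eq_bigl (fun A : {set 'I_N.+1} => x \notin A)); last first.
  move=> A; rewrite negbK finset.setU11 /=; apply/eqP/idP => [<-|xA].
    by rewrite !inE eqxx.
  by rewrite finset.setU1K.
rewrite -big_split /=; apply: eq_bigr => A xA.
rewrite mulrDr !mulrA /bernoulli_mass; congr (_ * _ + _ * _).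
  by rewrite (bigD1 x) //= (negbTE xA) mulrC.
rewrite (bigD1 x) //= finset.setU11 mulrC; congr (_ * _).
by apply: eq_bigr => n nx; rewrite !inE (negbTE nx).
Qed.

Lemma Ex_cond x F :
  Ex F = (1 - q) * Ex (fun A => F (A :\ x)) + q * Ex (fun A => F (x |: A)).
Proof.
rewrite !(Ex_split x) !mulr_sumr -big_split; apply: eq_bigr => A xA /=.
have -> : A :\ x = A by apply/finset.setDidPl; rewrite disjoint_sym disjoints1.
rewrite finset.setU1K // finset.setUA finset.setUid; ring.
Qed.

Lemma Ex_avoid (S : {set 'I_N.+1}) F :
  Ex (fun A => [disjoint S & A]%:R * F A) =
  (1 - q) ^+ #|S| * Ex (fun A => F (A :\: S)).
Proof.
move: {2}#|S| (erefl #|S|) => n; elim: n => [|n IH] in S F *.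
  move/eqP; rewrite cards_eq0 => /eqP ->; rewrite cards0 mul1r.
  apply: eq_Ex => A.
  by rewrite finset.setD0 -finset.setI_eq0 finset.set0I eqxx mul1r.
move=> Sn; have /card_gt0P[x xS] : (0 < #|S|)%N by rewrite Sn.
have S'n : #|S :\ x| = n by move: Sn; rewrite (cardsD1 x) xS => -[].
rewrite (Ex_cond x).
under [X in q * X]eq_Ex => A.
  have -> : [disjoint S & x |: A] = false.
    by apply/negbTE/pred0Pn; exists x; rewrite /= xS finset.setU11.
  rewrite mul0r; over.
rewrite Ex_cst mulr0 addr0.
under eq_Ex => A.
  have -> : [disjoint S & A :\ x] = [disjoint S :\ x & A].
    rewrite -!finset.setI_eq0; congr (_ == _).
    by apply/finset.setP => y; rewrite !inE; case: (y == x); rewrite /= ?andbF.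
  over.
rewrite (IH _ (fun A => F (A :\ x)) S'n) S'n Sn mulrA -exprS; congr (_ * _).
apply: eq_Ex => A; congr F; apply/finset.setP => y; rewrite !inE.
by case: (eqVneq y x) => [->|]; rewrite ?xS.
Qed.

Hypothesis q01 : 0 <= q <= 1.

Lemma bernoulli_mass_ge0 (A : {set 'I_N.+1}) : 0 <= bernoulli_mass q A.
Proof.
by case/andP: q01 => q0 q1; apply: prodr_ge0 => n _; case: ifP => _; lra.
Qed.

Lemma le_Ex F G : (forall A, F A <= G A) -> Ex F <= Ex G.
Proof.
by move=> FG; apply: ler_sum => A _; rewrite ler_wpM2l ?bernoulli_mass_ge0.
Qed.

Lemma Ex_ge0 F : (forall A, 0 <= F A) -> 0 <= Ex F.
Proof. by move=> F0; rewrite -(Ex_cst 0); apply: le_Ex. Qed.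

Lemma markov_Pr (E : {set {set 'I_N.+1}}) F (t : R) : 0 < t ->
  (forall A, 0 <= F A) -> (forall A, A \in E -> t <= F A) ->
  Pr q E <= Ex F / t.
Proof.
move=> t0 F0 FE; rewrite ler_pdivlMr // mulrC PrE -ExZ; apply: le_Ex => A.
by case: (boolP (A \in E)) => [/FE|_]; rewrite ?mulr1 ?mulr0.
Qed.

End Expectation.

(** * Independence of the random set in a graph of bounded degree *)

Section ExponentialEstimates.
Variable R : realType.
Implicit Types x q : R.

Lemma expRN_le_inv x : 0 <= x -> expR (- x) <= (1 + x)^-1.
Proof.
by move=> x0; rewrite expRN lef_pV2 ?posrE ?expR_gt0 ?expR_ge1Dx //; lra.
Qed.

Lemma expRN_le_quadratic x : 0 <= x -> expR (- x) <= 1 - x + x ^+ 2.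
Proof.
move=> x0; apply: le_trans (expRN_le_inv x0) _.
rewrite -[_^-1]mul1r ler_pdivrMr; last by lra.
have : 0 <= x ^+ 3 by rewrite exprn_ge0.
by rewrite !exprS; lra.
Qed.

Lemma bernoulli_ineq q n : 0 <= q <= 1 -> 1 - q * n%:R <= (1 - q) ^+ n.
Proof.
case/andP=> q0 q1; elim: n => [|n IH]; first by rewrite expr0; lra.
rewrite exprS; apply: (@le_trans _ _ ((1 - q) * (1 - q * n%:R))).
  have : 0 <= q * q * n%:R by rewrite !mulr_ge0.
  by rewrite -natr1; lra.
by rewrite ler_wpM2l; lra.
Qed.

Lemma vertex_step_upper q (d D : nat) : 0 <= q -> 2 * D%:R * q <= 1 ->
  (0 < d <= D)%N ->
  let b := q ^+ 2 * (1 - 2 * D%:R * q) in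
  is_true ((1 - q) + q * ((1 - q) ^+ d * expR (b * (d * D)%:R)) <=
    expR (- (b * d%:R))).
Proof.
move=> q0 qD /andP[d0 dD] b.
have d1 : 1 <= d%:R :> R by rewrite ler1n.
have dDR : d%:R <= D%:R :> R by rewrite ler_nat.
have dq0 : 0 <= d%:R * q by rewrite mulr_ge0.
have q1 : q <= 1.
  have : 0 <= (D%:R - 1) * q by rewrite mulr_ge0 //; lra.
  by lra.
have b0 : 0 <= b by rewrite mulr_ge0 ?exprn_ge0 //; lra.
have bq : b <= q ^+ 2.
  have : 0 <= q ^+ 2 * (2 * D%:R * q) by rewrite !mulr_ge0 ?exprn_ge0 //.
  by rewrite /b; lra.
set z := q * d%:R - q ^+ 2 * (d * D)%:R.
have z0 : 0 <= z.
  have : 0 <= q * d%:R * (1 - D%:R * q).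
    by rewrite mulr_ge0 ?mulr_ge0 //; have := mulr_ge0 (ler0n R D) q0; lra.
  by rewrite /z natrM; lra.
have zq : z <= q * d%:R.
  have : 0 <= q ^+ 2 * (d * D)%:R by rewrite mulr_ge0 ?exprn_ge0.
  by rewrite /z; lra.
have step : (1 - q) ^+ d * expR (b * (d * D)%:R) <= expR (- z).
  have -> : - z = - q * d%:R + q ^+ 2 * (d * D)%:R by rewrite /z; ring.
  rewrite expRD; apply: ler_pM => //.
  - by rewrite exprn_ge0 //; lra.
  - rewrite mulrC expRM_natl lerXn2r ?nnegrE ?expR_ge0 //; first by lra.
    by have := expR_ge1Dx (- q); lra.
  - by rewrite ler_expR ler_wpM2r.
have := expRN_le_quadratic z0; have := expR_ge1Dx (- (b * d%:R)).
have z2 : z ^+ 2 <= (q * d%:R) ^+ 2 by rewrite lerXn2r ?nnegrE //; lra.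
have : q * ((1 - q) ^+ d * expR (b * (d * D)%:R)) <=
    q * (1 - z + (q * d%:R) ^+ 2).
  rewrite ler_wpM2l //; apply: le_trans step _.
  by apply: le_trans (expRN_le_quadratic z0) _; lra.
have : 0 <= q ^+ 3 * d%:R * (D%:R - d%:R).
  by rewrite !mulr_ge0 ?exprn_ge0 //; lra.
rewrite /z /b natrM; lra.
Qed.

Lemma vertex_step_lower q (d D : nat) : 0 <= q <= 1 -> D%:R * q ^+ 2 < 1 ->
  (d <= D)%N ->
  let a := q ^+ 2 / (1 - D%:R * q ^+ 2) in
  is_true (expR (- (a * d%:R)) <= (1 - q) + q * (1 - q) ^+ d).
Proof.
move=> /andP[q0 q1] qD dD a.
have dDR : d%:R <= D%:R :> R by rewrite ler_nat.
have a0 : 0 <= a by rewrite divr_ge0 ?exprn_ge0 //; lra.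
have ad0 : 0 <= a * d%:R by rewrite mulr_ge0.
apply: le_trans (expRN_le_inv ad0) _.
apply: (@le_trans _ _ (1 - q ^+ 2 * d%:R)).
  rewrite -[_^-1]mul1r ler_pdivrMr; last by lra.
  have aE : a * (1 - D%:R * q ^+ 2) = q ^+ 2 by rewrite mulfVK //; lra.
  have : 0 <= (a * d%:R) * (q ^+ 2 * (D%:R - d%:R)).
    by rewrite mulr_ge0 // mulr_ge0 ?exprn_ge0 // subr_ge0.
  have : a * (1 - D%:R * q ^+ 2) * d%:R = q ^+ 2 * d%:R by rewrite aE.
  by lra.
have : q * (1 - q * d%:R) <= q * (1 - q) ^+ d.
  by rewrite ler_wpM2l // bernoulli_ineq // q0.
lra.
Qed.

End ExponentialEstimates.

Section IndependentSets.
Variable T : finType.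
Implicit Types (E : {set T * T}) (A S : {set T}) (x y : T).

Definition indep E A := [forall e in E, ~~ ((e.1 \in A) && (e.2 \in A))].

Definition touch E S : {set T * T} :=
  [set e in E | (e.1 \in S) || (e.2 \in S)].

Definition nbr E x : {set T} :=
  [set (if e.1 == x then e.2 else e.1) | e in touch E [set x]].

(* Excludes loops as well as opposite pairs, so that distinct elements of E are
   distinct edges. *)
Definition asym E := forall x y, (x, y) \in E -> (y, x) \notin E.

Lemma indepS E E' A : E' \subset E -> indep E A -> indep E' A.
Proof.
move=> /fintype.subsetP sE /'forall_implyP iE.
by apply/'forall_implyP => e /sE; apply: iE.
Qed.

Lemma indepU E E' A : indep (E :|: E') A = indep E A && indep E' A.
Proof.
apply/idP/andP => [i|[/'forall_implyP i /'forall_implyP i']].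
  by split; apply: indepS i; rewrite ?finset.subsetUl ?finset.subsetUr.
by apply/'forall_implyP => e; rewrite inE => /orP[/i|/i'].
Qed.

Lemma indepD E A S : indep E (A :\: S) = indep (E :\: touch E S) A.
Proof.
apply: eq_forallb => e; rewrite !inE.
by case: (e \in E); case: (e.1 \in S); case: (e.2 \in S); rewrite ?andbF ?andbT.
Qed.

Lemma indepU1 E x A : (x, x) \notin E ->
  indep E (x |: A) =
  [disjoint nbr E x & A] && indep (E :\: touch E [set x]) A.
Proof.
move=> xxE; apply/'forall_implyP/andP=> [iE|[dis /'forall_implyP iE] [a b] abE].
  split.
    rewrite disjoint_subset; apply/fintype.subsetP => y /imsetP[[a b]].
    rewrite !inE /= => /andP[abE abx] ->; have := iE _ abE; rewrite !inE /=.
    by case: (a == x) abx => /= [_|->]; rewrite ?andbT ?negb_or // => /andP[].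
  by apply/'forall_implyP => e; rewrite inE => /andP[_ /iE]; rewrite !inE;
    apply: contra => /andP[-> ->]; rewrite !orbT.
have [abx|abx] := boolP ((a == x) || (b == x)); last first.
  move: abx; rewrite negb_or => /andP[/negbTE ax /negbTE bx].
  by have := iE (a, b); rewrite !inE /= abE ax bx /=; apply.
have : (if a == x then b else a) \in nbr E x.
  by apply/imsetP; exists (a, b) => //; rewrite !inE abE.
move=> /(disjointFr dis); rewrite !inE /=.
case: (eqVneq a x) => [ax|ax] -> //; rewrite orbF.
by apply: contraNneq xxE => bx; rewrite -{1}ax -bx.
Qed.

Lemma card_nbr E x : asym E -> #|nbr E x| = #|touch E [set x]|.
Proof.
move=> aE; apply: card_in_imset => -[a b] [c d]; rewrite !inE /=.
move=> /andP[abE abx] /andP[cdE cdx].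
case: (eqVneq a x) abx => [ax|_] /= => [_|/eqP bx];
  case: (eqVneq c x) cdx => [cx|_] /= => [_|/eqP dx] e;
  move: (aE _ _ abE) (aE _ _ cdE).
- by rewrite ax cx e.
- by move: cdE; rewrite ax e dx => ->.
- by move: cdE; rewrite bx cx -e => ->.
- by rewrite bx dx e.
Qed.

Lemma card_touch_le E S (D : nat) :
  (forall x, #|touch E [set x]| <= D)%N -> (#|touch E S| <= #|S| * D)%N.
Proof.
move=> hD; rewrite -sum_nat_const.
apply: (@leq_trans (\sum_(x in S) #|touch E [set x]|)); last first.
  by apply: leq_sum => x _; apply: hD.
apply: (@leq_trans #|\bigcup_(x in S) touch E [set x]|).
  apply/subset_leq_card/fintype.subsetP => e; rewrite inE => /andP[eE] eS.
  apply/bigcupP; case/orP: eS => eS; [exists e.1|exists e.2] => //;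
  by rewrite !inE eE eqxx ?orbT.
elim/big_rec2: _ => [|x m U _ IH]; first by rewrite cards0.
by rewrite (leq_trans (leq_card_setU _ _).1) // leq_add2l.
Qed.

Lemma touchS E E' S : E' \subset E -> touch E' S \subset touch E S.
Proof.
move=> /fintype.subsetP sE; apply/fintype.subsetP => e.
by rewrite !inE => /andP[/sE -> ->].
Qed.

End IndependentSets.

Section IndependenceProbability.
Variables (R : realType) (q : R) (N : nat).
Implicit Types (E : {set 'I_N.+1 * 'I_N.+1}) (x : 'I_N.+1).
Hypothesis q01 : 0 <= q <= 1.

Definition pind E : R := Ex q (fun A => (indep E A)%:R).

Lemma pind_subset E E' : E' \subset E -> pind E <= pind E'.
Proof.
move=> sE; apply: (le_Ex q01) => A; rewrite ler_nat.
by case: (boolP (indep E A)) => // /(indepS sE) ->.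
Qed.

(* If x is in A, independence forces A to avoid the neighbours of x. *)
Lemma pind_vertex E x : asym E ->
  pind E = (1 - q) * pind (E :\: touch E [set x]) +
    q * ((1 - q) ^+ #|touch E [set x]| *
         pind ((E :\: touch E [set x]) :\:
               touch (E :\: touch E [set x]) (nbr E x))).
Proof.
move=> aE; rewrite {1}/pind (Ex_cond q x) -(card_nbr x aE).
congr (_ * _ + _ * _).
  by apply: eq_Ex => A; rewrite indepD.
have xxE : (x, x) \notin E by apply/negP => h; move: (aE _ _ h); rewrite h.
under eq_Ex => A do rewrite (indepU1 _ xxE) -mulnb natrM.
rewrite (Ex_avoid q _ (fun A => (indep _ A)%:R)); congr (_ * _).
by apply: eq_Ex => A; rewrite indepD.
Qed.

Lemma pind_upper E (D : nat) : 2 * D%:R * q <= 1 -> asym E ->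
  (forall x, #|touch E [set x]| <= D)%N ->
  pind E <= expR (- (q ^+ 2 * (1 - 2 * D%:R * q) * #|E|%:R)).
Proof.
move=> qD; move: {2}#|E| (leqnn #|E|) => n; elim: n E => [|n IH] E.
  rewrite leqn0 => /eqP E0 _ _; rewrite E0 mulr0 oppr0 expR0.
  rewrite -[leRHS](Ex_cst q N); apply: (le_Ex q01) => A.
  by rewrite lern1 leq_b1.
move=> En aE hD.
have [->|] := eqVneq E finset.set0.
  rewrite cards0 mulr0 oppr0 expR0.
  rewrite -[leRHS](Ex_cst q N); apply: (le_Ex q01) => A.
  by rewrite lern1 leq_b1.
move=> /finset.set0Pn[[x y] xyE].
set b := q ^+ 2 * _ in IH *.
set d := #|touch E [set x]|.
have d0 : (0 < d)%N by apply/card_gt0P; exists (x, y); rewrite !inE xyE eqxx.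
have tE : touch E [set x] \subset E.
  by apply/fintype.subsetP => e; rewrite inE => /andP[].
set E' := E :\: touch E [set x]; set E'' := E' :\: touch E' (nbr E x).
have E'E : E' \subset E by apply: finset.subsetDl.
have E''E : E'' \subset E.
  by apply: fintype.subset_trans E'E; apply: finset.subsetDl.
have subIH (F : {set _}) : F \subset E -> (#|F| < #|E|)%N ->
    pind F <= expR (- (b * #|F|%:R)).
  move=> FE Fn; apply: IH.
  - by rewrite -ltnS (leq_trans Fn).
  - move=> u v /(fintype.subsetP FE) /aE; apply: contra.
    exact: (fintype.subsetP FE).
  - move=> z; apply: leq_trans (hD z); apply: subset_leq_card; exact: touchS.
have cE' : (#|E'| + d = #|E|)%N.
  by rewrite addnC -(cardsID (touch E [set x]) E) (finset.setIidPr tE).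
have cE'' : (#|E'| <= #|E''| + d * D)%N.
  rewrite -(cardsID (touch E' (nbr E x)) E') addnC leq_add2l.
  apply: leq_trans (subset_leq_card (finset.subsetIr _ _)) _.
  rewrite /d -(card_nbr x aE); apply: card_touch_le => z.
  by apply: leq_trans (hD z); apply: subset_leq_card; exact: touchS.
have lE' : (#|E'| < #|E|)%N by rewrite -cE' -[ltnLHS]addn0 ltn_add2l.
have lE'' : (#|E''| < #|E|)%N.
  by apply: leq_ltn_trans lE'; apply: subset_leq_card; apply: finset.subsetDl.
rewrite (pind_vertex x aE) -/d -/E' -/E''.
have [q0 q1] := andP q01.
have b0 : 0 <= b by rewrite mulr_ge0 ?exprn_ge0 //; lra.
have pE'' : pind E'' <= expR (b * (d * D)%:R) * expR (- (b * #|E'|%:R)).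
  apply: le_trans (subIH _ E''E lE'') _; rewrite -expRD ler_expR.
  have : b * #|E'|%:R <= b * (#|E''| + d * D)%:R.
    by rewrite ler_wpM2l // ler_nat.
  by rewrite natrD; lra.
apply: (@le_trans _ _ (((1 - q) + q * ((1 - q) ^+ d * expR (b * (d * D)%:R))) *
   expR (- (b * #|E'|%:R)))).
  rewrite [leRHS]mulrDl; apply: lerD.
    by rewrite ler_wpM2l ?subIH // subr_ge0.
  by rewrite -mulrA ler_wpM2l // -mulrA ler_wpM2l // exprn_ge0 // subr_ge0.
have -> : - (b * #|E|%:R) = - (b * d%:R) + - (b * #|E'|%:R).
  by rewrite -cE' natrD; ring.
rewrite expRD ler_wpM2r ?expR_ge0 //.
by apply: vertex_step_upper => //; rewrite d0 hD.
Qed.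

Lemma pind_lower E (D : nat) : D%:R * q ^+ 2 < 1 -> asym E ->
  (forall x, #|touch E [set x]| <= D)%N ->
  expR (- (q ^+ 2 / (1 - D%:R * q ^+ 2) * #|E|%:R)) <= pind E.
Proof.
move=> qD; move: {2}#|E| (leqnn #|E|) => n; elim: n E => [|n IH] E En aE hD;
  have [q0 q1] := andP q01; have [E0|] := eqVneq E finset.set0.
- rewrite E0 cards0 mulr0 oppr0 expR0 -[leLHS](Ex_cst q N).
  apply: (le_Ex q01) => A; rewrite ler1n lt0b.
  by apply/'forall_implyP => e; rewrite inE.
- by rewrite -cards_eq0 -leqn0 En.
- rewrite E0 cards0 mulr0 oppr0 expR0 -[leLHS](Ex_cst q N).
  apply: (le_Ex q01) => A; rewrite ler1n lt0b.
  by apply/'forall_implyP => e; rewrite inE.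
move=> /finset.set0Pn[[x y] xyE].
set a := q ^+ 2 / _ in IH *.
set d := #|touch E [set x]|.
have d0 : (0 < d)%N by apply/card_gt0P; exists (x, y); rewrite !inE xyE eqxx.
have tE : touch E [set x] \subset E.
  by apply/fintype.subsetP => e; rewrite inE => /andP[].
rewrite (pind_vertex x aE) -/d.
set E' := E :\: touch E [set x]; set E'' := E' :\: touch E' (nbr E x).
have E'E : E' \subset E by apply: finset.subsetDl.
have cE' : (#|E'| + d = #|E|)%N.
  by rewrite addnC -(cardsID (touch E [set x]) E) (finset.setIidPr tE).
have pE' : expR (- (a * #|E'|%:R)) <= pind E'.
  apply: IH.
  - by rewrite -ltnS (leq_trans _ En) // -cE' -[ltnLHS]addn0 ltn_add2l.
  - move=> u v /(fintype.subsetP E'E) /aE; apply: contra.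
    exact: (fintype.subsetP E'E).
  - move=> z; apply: leq_trans (hD z); apply: subset_leq_card; exact: touchS.
have pE'' : expR (- (a * #|E'|%:R)) <= pind E''.
  by apply: le_trans pE' _; apply/pind_subset/finset.subsetDl.
have -> : - (a * #|E|%:R) = - (a * d%:R) + - (a * #|E'|%:R).
  by rewrite -cE' natrD; ring.
rewrite expRD.
apply: (@le_trans _ _ (((1 - q) + q * (1 - q) ^+ d) *
  expR (- (a * #|E'|%:R)))).
  by rewrite ler_wpM2r ?expR_ge0 //; apply: vertex_step_lower => //; rewrite hD.
rewrite [leLHS]mulrDl; apply: lerD; first by rewrite ler_wpM2l // subr_ge0.
by rewrite -mulrA ler_wpM2l // ler_wpM2l // exprn_ge0 // subr_ge0.
Qed.

Lemma pind_remove_vertex E x : (1 - q) * pind (E :\: touch E [set x]) <= pind E.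
Proof.
rewrite [leRHS](Ex_cond q x) -[leLHS]addr0; have [q0 q1] := andP q01.
apply: lerD; last by rewrite mulr_ge0 // (Ex_ge0 q01).
by under [in leRHS]eq_Ex do rewrite indepD.
Qed.

End IndependenceProbability.

Section FormEdges.
Variables (u v : int) (N : nat).
Hypotheses (u_neq0 : u != 0) (v_neq0 : v != 0) (uv : u != v).
Implicit Types (k l : int) (x y : 'I_N.+1).

Definition edges k : {set 'I_N.+1 * 'I_N.+1} :=
  [set e : 'I_N.+1 * 'I_N.+1 | linform u v (e.1 : nat)%:Z (e.2 : nat)%:Z == k].

Lemma indep_edges k (A : {set 'I_N.+1}) :
  indep (edges k) A = (k \notin form_image (linform u v) A).
Proof.
apply/'forall_implyP/idP => [iE|kA [x y]].
  apply/negP => /imfset2P[x xA [y yA kxy]].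
  have xyk : (x, y) \in edges k by rewrite inE /= -kxy.
  by have := iE _ xyk; rewrite /= xA yA.
rewrite inE /= => /eqP kxy; apply: contra kA => /andP[xA yA].
by rewrite -kxy; apply/imfset2P; exists x => //; exists y.
Qed.

Lemma linform_injl (x x' y : int) :
  linform u v x y = linform u v x' y -> x = x'.
Proof. by move/addIr/(mulfI u_neq0). Qed.

Lemma linform_injr (x y y' : int) :
  linform u v x y = linform u v x y' -> y = y'.
Proof. by move/addrI/(mulfI v_neq0). Qed.

Lemma card_touch_edges k x : (#|touch (edges k) [set x]| <= 2)%N.
Proof.
set E1 := [set e in edges k | e.1 == x].
set E2 := [set e in edges k | e.2 == x].
have sub : touch (edges k) [set x] \subset E1 :|: E2.
  apply/fintype.subsetP => e; rewrite !inE => /andP[-> /orP[]->];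
  by rewrite ?orbT.
apply: leq_trans (subset_leq_card sub) _.
apply: leq_trans (leq_card_setU _ _).1 _; rewrite (@leq_add _ _ 1 1) //.
  apply/card_le1_eqP => -[a b] [c d]; rewrite !inE /=.
  move=> /andP[/eqP <- /eqP ->] /andP[/eqP cd /eqP cx].
  by rewrite cx in cd *; move: cd => /linform_injr[/val_inj ->].
apply/card_le1_eqP => -[a b] [c d]; rewrite !inE /=.
move=> /andP[/eqP <- /eqP ->] /andP[/eqP cd /eqP dx].
by rewrite dx in cd *; move: cd => /linform_injl[/val_inj ->].
Qed.

Lemma card_touch_edgesU k l x : (#|touch (edges k :|: edges l) [set x]| <= 4)%N.
Proof.
have sub : touch (edges k :|: edges l) [set x] \subset
    touch (edges k) [set x] :|: touch (edges l) [set x].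
  by apply/fintype.subsetP => e; rewrite !inE andb_orl.
apply: leq_trans (subset_leq_card sub) _.
apply: leq_trans (leq_card_setU _ _).1 _.
by rewrite (@leq_add _ _ 2 2) // card_touch_edges.
Qed.

Definition reversed k l := [set e in edges l | (e.2, e.1) \in edges k].

Lemma card_reversed k l : ~~ ((u + v == 0) && (k + l == 0)) ->
  (#|reversed k l| <= 1)%N.
Proof.
move=> exc; apply/card_le1_eqP => -[a b] [c d]; rewrite !inE /= /linform.
move=> /andP[/eqP abl /eqP abk] /andP[/eqP cdl /eqP cdk].
have uv0 : u + v != 0.
  apply: contra exc => /eqP uv0; rewrite uv0 eqxx /=; apply/eqP; nia.
have e1 : (u + v) *
    ((a : nat)%:Z + (b : nat)%:Z - (c : nat)%:Z - (d : nat)%:Z) = 0 by lia.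
have e2 : (u - v) *
    ((a : nat)%:Z - (b : nat)%:Z - (c : nat)%:Z + (d : nat)%:Z) = 0 by lia.
move/eqP: e1; rewrite mulf_eq0 (negbTE uv0) /= => /eqP e1.
move/eqP: e2; rewrite mulf_eq0 subr_eq0 (negbTE uv) /= => /eqP e2.
by congr (_, _); apply/val_inj => /=; lia.
Qed.

Lemma reversed_loop k x y : (x, y) \in reversed k k -> x = y.
Proof.
rewrite !inE /= /linform => /andP[/eqP h1 /eqP h2]; apply/val_inj => /=.
have /eqP : (u - v) * ((x : nat)%:Z - (y : nat)%:Z) = 0 by lia.
by rewrite mulf_eq0 subr_eq0 (negbTE uv) /= => /eqP; lia.
Qed.

Variables (R : realType) (q : R).
Hypothesis q01 : 0 <= q <= 1.
Local Notation r k := (#|edges k|%:R : R).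

Lemma pind_edges_lower k : 4 * q ^+ 2 < 1 -> ~~ ((u + v == 0) && (k == 0)) ->
  (1 - q) * expR (- (q ^+ 2 / (1 - 4 * q ^+ 2) * r k)) <= pind q (edges k).
Proof.
move=> q4 exc; have [q0 q1] := andP q01.
have a0 : 0 <= q ^+ 2 / (1 - 4 * q ^+ 2).
  by rewrite divr_ge0 ?exprn_ge0 // subr_ge0 ltW.
have card1 : (#|reversed k k| <= 1)%N.
  by apply: card_reversed; apply: contra exc => /andP[-> /eqP]; lia.
have [E0|/finset.set0Pn[[x y] xyr]] := eqVneq (reversed k k) finset.set0.
  apply: (@le_trans _ _ (expR (- (q ^+ 2 / (1 - 4 * q ^+ 2) * r k)))).
    by rewrite ler_piMl ?expR_ge0 //; lra.
  apply: (@pind_lower _ q N q01 (edges k) 4) => // [a b abk|x].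
    apply: contraT; rewrite negbK => bak.
    by have := finset.in_set0 (a, b); rewrite -E0 inE abk bak.
  by apply: leq_trans (card_touch_edges k x) _.
have xy : x = y by exact: reversed_loop xyr.
apply: le_trans (pind_remove_vertex q01 (edges k) x).
rewrite ler_wpM2l ?subr_ge0 //.
set E := edges k :\: _.
have EE : E \subset edges k by exact: finset.subsetDl.
apply: (@le_trans _ _ (expR (- (q ^+ 2 / (1 - 4 * q ^+ 2) * #|E|%:R)))).
  by rewrite ler_expR lerN2 ler_wpM2l // ler_nat subset_leq_card.
apply: (@pind_lower _ q N q01 E 4) => // [a b|z].
  move=> abE; apply: contraT; rewrite negbK => baE.
  have abr : (a, b) \in reversed k k.
    by rewrite inE (fintype.subsetP EE _ abE) (fintype.subsetP EE _ baE).
  have := card_le1_eqP card1 _ _ abr xyr; move=> [ax _].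
  by move: abE; rewrite -ax !inE eqxx /= andbT andNb.
apply: leq_trans (subset_leq_card (touchS _ EE)) _.
by apply: leq_trans (card_touch_edges k z) _.
Qed.

Lemma pind_edges_upper k : 8 * q <= 1 -> ~~ ((u + v == 0) && (k == 0)) ->
  pind q (edges k) <= expR (q ^+ 2 * (1 - 8 * q)) *
    expR (- (q ^+ 2 * (1 - 8 * q) * r k)).
Proof.
move=> q8 exc; have [q0 q1] := andP q01.
have b0 : 0 <= q ^+ 2 * (1 - 8 * q) by rewrite mulr_ge0 ?exprn_ge0 // subr_ge0.
set E := edges k :\: reversed k k.
have EE : E \subset edges k by exact: finset.subsetDl.
apply: le_trans (pind_subset q01 EE) _.
have cE : (#|edges k| <= #|E| + 1)%N.
  rewrite -(cardsID (reversed k k) (edges k)) addnC leq_add2l.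
  apply: leq_trans (subset_leq_card (finset.subsetIr _ _)) _.
  by apply: card_reversed; apply: contra exc => /andP[-> /eqP]; lia.
apply: (@le_trans _ _ (expR (- (q ^+ 2 * (1 - 8 * q) * #|E|%:R)))).
  have -> : (8 : R) = 2 * 4%:R by ring.
  apply: (@pind_upper _ q N q01 E 4) => // [|a b abE|z]; first by lra.
    by move: abE; rewrite !inE /=; case: (_ == k); case: (_ == k).
  apply: leq_trans (subset_leq_card (touchS _ EE)) _.
  by apply: leq_trans (card_touch_edges k z) _.
rewrite -expRD ler_expR.
have : r k <= (#|E| + 1)%:R by rewrite ler_nat.
by move/(ler_wpM2l b0); rewrite natrD; lra.
Qed.

Lemma pind_edgesU_upper k l : 8 * q <= 1 -> k != l ->
  ~~ ((u + v == 0) && [|| k == 0, l == 0 | k + l == 0]) ->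
  pind q (edges k :|: edges l) <= expR (3 * (q ^+ 2 * (1 - 8 * q))) *
    (expR (- (q ^+ 2 * (1 - 8 * q) * r k)) *
     expR (- (q ^+ 2 * (1 - 8 * q) * r l))).
Proof.
move=> q8 kl exc; have [q0 q1] := andP q01.
have b0 : 0 <= q ^+ 2 * (1 - 8 * q) by rewrite mulr_ge0 ?exprn_ge0 // subr_ge0.
set Ek := edges k :\: reversed k k.
set El := edges l :\: (reversed l l :|: reversed k l).
have Ekk : Ek \subset edges k by exact: finset.subsetDl.
have Ell : El \subset edges l by exact: finset.subsetDl.
have EE : Ek :|: El \subset edges k :|: edges l by exact: finset.setUSS.
have ckk : (#|reversed k k| <= 1)%N.
  by apply: card_reversed; apply: contra exc => /andP[-> /eqP]; lia.
have cll : (#|reversed l l| <= 1)%N.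
  by apply: card_reversed; apply: contra exc => /andP[-> /eqP]; lia.
have ckl : (#|reversed k l| <= 1)%N.
  by apply: card_reversed; apply: contra exc => /andP[-> ->]; rewrite !orbT.
have cEk : (#|edges k| <= #|Ek| + 1)%N.
  rewrite -(cardsID (reversed k k) (edges k)) addnC leq_add2l.
  exact: leq_trans (subset_leq_card (finset.subsetIr _ _)) _.
have cEl : (#|edges l| <= #|El| + 2)%N.
  rewrite -(cardsID (reversed l l :|: reversed k l) (edges l)) addnC leq_add2l.
  apply: leq_trans (subset_leq_card (finset.subsetIr _ _)) _.
  by apply: leq_trans (leq_card_setU _ _).1 _; rewrite (@leq_add _ _ 1 1).
have cE : (#|Ek :|: El| = #|Ek| + #|El|)%N.
  apply/eqP; rewrite (leq_card_setU _ _).2 disjoint_subset.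
  apply/fintype.subsetP => e /(fintype.subsetP Ekk); rewrite !inE => /eqP ->.
  by rewrite (negbTE kl) andbF.
apply: le_trans (pind_subset q01 EE) _.
apply: (@le_trans _ _ (expR (- (q ^+ 2 * (1 - 8 * q) * #|Ek :|: El|%:R)))).
  have -> : (8 : R) = 2 * 4%:R by ring.
  apply: (@pind_upper _ q N q01 _ 4) => // [|a b|z]; first by lra.
    rewrite !inE /= => h; apply/negP; move: h.
    by case: (_ == k); case: (_ == l); case: (_ == k); case: (_ == l).
  apply: leq_trans (subset_leq_card (touchS _ EE)) _.
  exact: card_touch_edgesU.
rewrite -!expRD ler_expR.
have : r k + r l <= (#|Ek :|: El| + 3)%:R by rewrite -natrD ler_nat cE; lia.
by move/(ler_wpM2l b0); rewrite natrD; lra.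
Qed.

End FormEdges.

(** * Number of representations of a value *)

Section Representations.
Local Open Scope nat_scope.

Lemma count_residue (W c b : nat) : c < W ->
  \sum_(0 <= x < b) (x %% W == c) = (b + (W - c.+1)) %/ W.
Proof.
move=> cW; elim: b => [|b IH].
  by rewrite big_nil add0n divn_small //; lia.
rewrite big_nat_recr //= IH addSn divnS; last by lia.
rewrite addnC; congr (nat_of_bool _ + _).
rewrite -addnS subnSK // -{1}(modn_small cW).
rewrite -(eqn_modDr (W - c) b c) subnKC ?(ltnW cW) //.
by rewrite modnn /dvdn.
Qed.

Lemma count_residue_itv (W c lo hi : nat) : c < W -> lo <= hi ->
  let s := \sum_(lo <= x < hi) (x %% W == c) in
  s * W <= hi - lo + W /\ hi - lo <= s * W + W.
Proof.
move=> cW lohi s; have W0 : 0 < W by lia.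
have := count_residue hi cW.
rewrite (@big_cat_nat _ _ _ lo) //= count_residue // -/s.
have := divn_eq (lo + (W - c.+1)) W; have := divn_eq (hi + (W - c.+1)) W.
have := ltn_pmod (lo + (W - c.+1)) W0; have := ltn_pmod (hi + (W - c.+1)) W0.
move: (_ %/ W) (_ %/ W) (_ %% W) (_ %% W) => x y a b.
by move=> ha hb h1 h2 h3; split; nia.
Qed.

Lemma solve_congruence (U W i : nat) : 0 < W -> coprime U W ->
  exists2 c, c < W & forall x, (U * x == i %[mod W]) = (x %% W == c).
Proof.
move=> W0 cUW.
have /dvdnP[t zt] : U %| chinese U W 0 i.
  by rewrite /dvdn (chinese_modl cUW) mod0n.
have zi := chinese_modr cUW 0 i.
exists (t %% W); first by rewrite ltn_mod.
have cong a b : a <= b -> (U * a == U * b %[mod W]) = (a == b %[mod W]).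
  move=> ab; rewrite [LHS]eq_sym [RHS]eq_sym.
  rewrite !eqn_mod_dvd ?leq_mul2l ?ab ?orbT //.
  by rewrite -mulnBr Gauss_dvdr // coprime_sym.
move=> x; rewrite -zi zt [t * U]mulnC.
case/orP: (leq_total x t) => h; first exact: cong.
by rewrite [LHS]eq_sym [RHS]eq_sym; exact: cong.
Qed.

Lemma card_representations (U W N i : nat) : 0 < W -> W <= U -> coprime U W ->
  i <= (U + W) * N ->
  let r := #|[set e : 'I_N.+1 * 'I_N.+1 | U * e.1 + W * e.2 == i]| in
  let m := minn (minn i ((U + W) * N - i)) (W * N) in
  r * (U * W) <= m + 3 * (U * W) /\ m <= r * (U * W) + 3 * (U * W).
Proof.
move=> W0 WU cUW iN r m; have U0 : 0 < U by lia.
have [c cW hc] := solve_congruence i W0 cUW.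
have [d [r0 [iU r0U]]] : exists d r0, i = d * U + r0 /\ r0 < U.
  by exists (i %/ U), (i %% U); rewrite -divn_eq ltn_pmod.
have [lo [r1 [lU r1U]]] :
    exists lo r1, i - W * N + U.-1 = lo * U + r1 /\ r1 < U.
  by exists ((i - W * N + U.-1) %/ U), ((i - W * N + U.-1) %% U);
    rewrite -divn_eq ltn_pmod.
set hi := (minn N d).+1.
have lohi : lo <= hi by rewrite /hi; clear -iU r0U lU r1U iN; nia.
have rE : r = \sum_(lo <= x < hi) (x %% W == c).
  transitivity #|[set x : 'I_N.+1 | (lo <= x < hi) && (x %% W == c)]|.
    rewrite /r -(card_in_imset (f := fst)) /=; last first.
      move=> [a b] [a' b']; rewrite !inE /= => /eqP h /eqP h' aa.
      rewrite -aa; congr (_, _); apply/val_inj => /=.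
      by move: h'; rewrite -aa -h => /addnI /eqP; rewrite eqn_pmul2l // => /eqP.
    congr #|pred_of_set _|; apply/finset.setP => x; rewrite inE -hc.
    apply/imsetP/idP => [[[a b]]|/andP[/andP[lox xhi] xc]].
      rewrite inE /= => /eqP h ->.
      have -> : U * a == i %[mod W] by rewrite -h addnC [W * b]mulnC modnMDl.
      rewrite andbT; have aN := ltn_ord a; have bN := ltn_ord b.
      by rewrite /hi; clear -aN bN h iU r0U lU r1U U0; nia.
    have Uxi : U * x <= i.
      by move: xhi; rewrite /hi; clear -iU; nia.
    have : W %| i - U * x by rewrite -eqn_mod_dvd // eq_sym.
    case/dvdnP=> y hy; have yN : y < N.+1.
      rewrite ltnS -(leq_pmul2r W0) -hy.
      have : lo * U <= x * U by rewrite leq_mul2r lox orbT.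
      clear -lU r1U Uxi; rewrite [x * U]mulnC [N * W]mulnC.
      by move: (lo * U) (U * x) (W * N) lU Uxi; lia.
    by exists (x, Ordinal yN) => //; rewrite inE /= [W * y]mulnC -hy subnKC.
  rewrite -sum1dep_card big_mkcond /=.
  rewrite (big_nat_widen _ _ N.+1) //; last by rewrite /hi; lia.
  rewrite (big_nat_widenl _ 0) // big_mkord [RHS]big_mkcond.
  apply: eq_bigr => x _ /=.
  by rewrite andbC; case: (lo <= x) => /=; case: (x < hi) => //=; case: eqP.
have := count_residue_itv cW lohi; rewrite /= -rE => -[h1 h2].
have WNUN : W * N <= U * N by rewrite leq_mul2r WU orbT.
have nU : (hi - lo) * U = minn (N * U) (d * U) + U - lo * U.
  by rewrite mulnBl /hi mulSn addnC; congr (_ + _ - _); rewrite minnMl.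
have loU : lo * U <= minn (N * U) (d * U) + U.
  by rewrite -minnMl addnC -mulSn leq_mul2r lohi orbT.
have [n1 n2] : (hi - lo) * U <= m + 2 * U /\ m <= (hi - lo) * U + 2 * U.
  rewrite nU /m mulnDl [N * U]mulnC; move: loU.
  rewrite [N * U]mulnC mulnDl in iN *; clear -iN iU r0U lU r1U WNUN.
  move: (U * N) (W * N) (d * U) (lo * U) iN iU lU WNUN.
  by lia.
have UW : U <= U * W by rewrite leq_pmulr.
have := leq_mul h1 (leqnn U); have := leq_mul h2 (leqnn U).
rewrite !mulnDl -mulnA [W * U]mulnC; clear -n1 n2 UW.
by move: (r * (U * W)) ((hi - lo) * U) (U * W) n1 n2 UW; lia.
Qed.

End Representations.

Section ImageValues.
Variables (u v : int) (N : nat).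
Hypotheses (u_gt0 : 0 < u) (v_neq0 : v != 0).
Local Notation U := `|u|%N.
Local Notation W := `|v|%N.

(* f(A) lies in min_value + [0, (|u| + |v|) N]. *)
Definition min_value : int := if 0 < v then 0 else v * N%:Z.

Lemma card_edges (i : nat) :
  #|edges u v N (i%:Z + min_value)| =
  #|[set e : 'I_N.+1 * 'I_N.+1 | U * e.1 + W * e.2 == i]%N|.
Proof.
rewrite /edges /linform /min_value; have [v0|v0] := ltP 0 v.
  congr #|pred_of_set _|; apply/finset.setP => e; rewrite !inE addr0.
  have {1}-> : u = U%:Z by rewrite gtz0_abs.
  have {1}-> : v = W%:Z by rewrite gtz0_abs.
  by rewrite -!PoszM -PoszD.
pose h (e : 'I_N.+1 * 'I_N.+1) := (e.1, rev_ord e.2).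
have hK : involutive h by case=> a b; rewrite /h /= rev_ordK.
rewrite -(card_preimset _ (inv_inj hK)).
congr #|pred_of_set _|; apply/finset.setP => -[a b]; rewrite !inE /=.
have {1}-> : u = U%:Z by rewrite gtz0_abs.
have {1 2}-> : v = - W%:Z by rewrite lez0_abs ?opprK.
have bN : (N.+1 - b.+1 + b = N)%N by have := ltn_ord b; lia.
move: (N.+1 - b.+1)%N bN (nat_of_ord a) => c /(congr1 (muln W)); rewrite mulnDr.
by move: (nat_of_ord b) => y bN x; apply/eqP/eqP; lia.
Qed.

Lemma form_image_value (A : {set 'I_N.+1}) k :
  k \in form_image (linform u v) A ->
  exists i : 'I_((U + W) * N).+1, k = (i : nat)%:Z + min_value.
Proof.
move=> /imfset2P[x _ [y _ ->]]; rewrite /min_value /linform.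
have xN := ltn_ord x; have yN := ltn_ord y.
have [v0|v0] := ltP 0 v.
  have iN : (U * x + W * y < ((U + W) * N).+1)%N by nia.
  by exists (Ordinal iN) => /=; rewrite PoszD !PoszM !gtz0_abs // addr0.
have iN : (U * x + W * (N - y) < ((U + W) * N).+1)%N by nia.
exists (Ordinal iN) => /=; rewrite PoszD !PoszM gtz0_abs // lez0_abs //.
by rewrite -subzn //; lia.
Qed.

End ImageValues.

Lemma card_fset_finType (K : choiceType) (T : finType) (h : T -> K)
    (S : {fset K}) : injective h ->
  (forall k, k \in S -> exists t, k = h t) ->
  #|` S|%fset = #|[set t | h t \in S]|.
Proof.
move=> h_inj hS; rewrite cardE -(size_map h); apply: perm_size.
apply: uniq_perm; rewrite ?fset_uniq ?map_inj_uniq ?enum_uniq // => k.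
apply/idP/mapP => [kS|[t]]; last by rewrite mem_enum inE => ht ->.
by have [t kt] := hS _ kS; exists t => //; rewrite mem_enum inE -kt.
Qed.

(** * Moments of the number of missing values *)

Section Missing.
Variables (R : realType) (u v : int) (N : nat) (q : R).
Hypotheses (u_gt0 : 0 < u) (v_neq0 : v != 0) (uv : u != v) (vu : `|v| <= u)
  (gcd_uv : gcdz u v = 1).
Local Notation U := `|u|%N.
Local Notation W := `|v|%N.
Local Notation K := ((U + W) * N).+1.
Local Notation value i := (((i : 'I_K) : nat)%:Z + min_value v N).

Definition trapezoid (i : nat) : nat :=
  minn (minn i ((U + W) * N - i)) (W * N).

Lemma card_edges_bounds (i : 'I_K) :
  #|edges u v N (value i)|%:R <= (trapezoid i)%:R / (U * W)%:R + 3 :> R /\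
  (trapezoid i)%:R / (U * W)%:R - 3 <= #|edges u v N (value i)|%:R :> R.
Proof.
have W0 : (0 < W)%N by rewrite absz_gt0.
have U0 : (0 < U)%N by rewrite absz_gt0 gt_eqF.
have WU : (W <= U)%N by lia.
have cUW : coprime U W.
  by rewrite /coprime; move: gcd_uv; rewrite /gcdz => -[->].
have := @card_representations U W N i W0 WU cUW (ltn_ord i).
rewrite /= -card_edges // -/(trapezoid i) => -[h1 h2].
have UW0 : 0 < (U * W)%:R :> R by rewrite ltr0n muln_gt0 U0.
split.
  by rewrite -lerBlDr ler_pdivlMr // mulrBl -!natrM lerBlDr -natrD ler_nat.
by rewrite lerBlDr ler_pdivrMr // mulrDl -!natrM -natrD ler_nat.
Qed.

Definition missing (A : {set 'I_N.+1}) : R :=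
  \sum_(i < K) (indep (edges u v N (value i)) A)%:R.

Lemma image_cardE (A : {set 'I_N.+1}) :
  image_card R (linform u v) A = K%:R - missing A.
Proof.
have inj : injective (fun i : 'I_K => value i).
  by move=> i j /addIr [] /val_inj.
rewrite /image_card (card_fset_finType inj); last first.
  by move=> k; apply: form_image_value.
rewrite /missing -natr_sum -(sum1dep_card) big_mkcond /=.
apply/eqP; rewrite eq_sym subr_eq -natrD -big_split /=.
rewrite (eq_bigr (fun=> 1%N)) ?sum1_card ?card_ord // => i _.
by rewrite indep_edges; case: (_ \in _).
Qed.

Lemma Ex_missing :
  Ex q missing = \sum_(i < K) pind q (edges u v N (value i)).
Proof. exact: Ex_sum. Qed.

Lemma Ex_missing2 :
  Ex q (fun A => missing A ^+ 2) = \sum_(i < K) \sum_(j < K)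
    pind q (edges u v N (value i) :|: edges u v N (value j)).
Proof.
under eq_Ex => A do rewrite expr2 mulr_suml.
rewrite Ex_sum; apply: eq_bigr => i _.
under eq_Ex => A do rewrite mulr_sumr.
rewrite Ex_sum; apply: eq_bigr => j _; apply: eq_Ex => A.
by rewrite indepU -mulnb natrM.
Qed.

Definition height_sum (x : R) : R :=
  \sum_(i < K) expR (- (x * ((trapezoid i)%:R / (U * W)%:R))).

Hypothesis q01 : 0 <= q <= 1.

Lemma pind_ge0 (E : {set 'I_N.+1 * 'I_N.+1}) : 0 <= pind q E.
Proof. exact: Ex_ge0. Qed.

Lemma pind_le1 (E : {set 'I_N.+1 * 'I_N.+1}) : pind q E <= 1.
Proof.
by rewrite -[leRHS](Ex_cst q N); apply: (le_Ex q01) => A; rewrite lern1 leq_b1.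
Qed.

Lemma sum_at_most_one (P : pred 'I_K) :
  (forall i j, P i -> P j -> i = j) -> \sum_(i < K) (P i)%:R <= 1 :> R.
Proof.
move=> hP; rewrite -natr_sum lern1.
rewrite (_ : (\sum_i P i)%N = #|[pred i | P i]|); last first.
  rewrite -sum1_card [RHS]big_mkcond; apply: eq_bigr => i _.
  by rewrite inE; case: (P i).
by apply/card_le1_eqP => i j; rewrite !inE => Pi Pj; exact: hP.
Qed.

Lemma value_inj k (i j : 'I_K) : value i == k -> value j == k -> i = j.
Proof. by move=> /eqP <- /eqP /addIr [] /val_inj. Qed.

Lemma value0_le1 : \sum_(i < K) (value i == 0)%:R <= 1 :> R.
Proof. by apply: sum_at_most_one; apply: value_inj. Qed.

Let a := q ^+ 2 / (1 - 4 * q ^+ 2).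
Let b := q ^+ 2 * (1 - 8 * q).

Lemma Ex_missing_lower : 4 * q ^+ 2 < 1 ->
  (1 - q) * (expR (- (3 * a)) * height_sum a) - 1 <= Ex q missing.
Proof.
move=> q4; have [q0 q1] := andP q01.
have a0 : 0 <= a by rewrite divr_ge0 ?exprn_ge0 // subr_ge0 ltW.
rewrite lerBlDr Ex_missing; apply: le_trans (lerD (lexx _) value0_le1).
rewrite -big_split /= mulr_sumr mulr_sumr; apply: ler_sum => i _.
have h : (1 - q) * (expR (- (3 * a)) *
    expR (- (a * ((trapezoid i)%:R / (U * W)%:R)))) <=
    (1 - q) * expR (- (a * #|edges u v N (value i)|%:R)).
  rewrite ler_wpM2l ?subr_ge0 // -expRD ler_expR.
  by have := ler_wpM2l a0 (card_edges_bounds i).1; lra.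
have [->|i0] := eqVneq (value i) 0.
  apply: ler_wpDl; first exact: pind_ge0.
  apply: le_trans h _; rewrite mulr_ile1 ?expR_ge0 ?subr_ge0 //; first by lra.
  by rewrite -expR0 ler_expR oppr_le0 mulr_ge0.
rewrite addr0; apply: le_trans h _.
by apply: pind_edges_lower => //; rewrite ?(negbTE i0) ?andbF // gt_eqF.
Qed.

Lemma pind_value_upper (i : 'I_K) : 8 * q <= 1 ->
  ~~ ((u + v == 0) && (value i == 0)) ->
  pind q (edges u v N (value i)) <= expR (4 * b) *
    expR (- (b * ((trapezoid i)%:R / (U * W)%:R))).
Proof.
move=> q8 exc; have [q0 q1] := andP q01.
have b0 : 0 <= b by rewrite mulr_ge0 ?exprn_ge0 // subr_ge0.
apply: le_trans (pind_edges_upper _ _ v_neq0 uv q01 q8 exc) _.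
  by rewrite gt_eqF.
rewrite -!expRD ler_expR -/b.
by have := ler_wpM2l b0 (card_edges_bounds i).2; lra.
Qed.

Lemma pind_valueU_upper (i j : 'I_K) : 8 * q <= 1 -> i != j ->
  ~~ ((u + v == 0) &&
      [|| value i == 0, value j == 0 | value i + value j == 0]) ->
  pind q (edges u v N (value i) :|: edges u v N (value j)) <= expR (9 * b) *
    (expR (- (b * ((trapezoid i)%:R / (U * W)%:R))) *
     expR (- (b * ((trapezoid j)%:R / (U * W)%:R)))).
Proof.
move=> q8 ij exc; have [q0 q1] := andP q01.
have b0 : 0 <= b by rewrite mulr_ge0 ?exprn_ge0 // subr_ge0.
have vij : value i != value j.
  by apply: contra ij => h; apply/eqP; apply: (value_inj h).
apply: le_trans (pind_edgesU_upper _ _ v_neq0 uv q01 q8 vij exc) _.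
  by rewrite gt_eqF.
rewrite -!expRD ler_expR -/b.
have := ler_wpM2l b0 (card_edges_bounds i).2.
by have := ler_wpM2l b0 (card_edges_bounds j).2; lra.
Qed.

Lemma Ex_missing_upper : 8 * q <= 1 ->
  Ex q missing <= expR (4 * b) * height_sum b + 1.
Proof.
move=> q8; rewrite Ex_missing; apply: le_trans (lerD (lexx _) value0_le1).
rewrite mulr_sumr -big_split /=; apply: ler_sum => i _.
have [i0|i0] := eqVneq (value i) 0.
  by apply: ler_wpDl; rewrite ?mulr_ge0 ?expR_ge0 ?pind_le1.
by rewrite addr0; apply: pind_value_upper => //; rewrite (negbTE i0) andbF.
Qed.

(* The pairs excluded in pind_valueU_upper each cost at most E M in total, since
   each of the four kinds meets a row (or a column) at most once. *)
Lemma Ex_missing2_upper : 8 * q <= 1 ->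
  Ex q (fun A => missing A ^+ 2) <=
    expR (9 * b) * height_sum b ^+ 2 + 4 * Ex q missing.
Proof.
move=> q8; set p := fun i : 'I_K => pind q (edges u v N (value i)).
have p0 i : 0 <= p i by exact: pind_ge0.
set B := fun i : 'I_K => expR (- (b * ((trapezoid i)%:R / (U * W)%:R))).
rewrite Ex_missing2.
apply: (@le_trans _ _ (\sum_i \sum_j (expR (9 * b) * (B i * B j) +
  ((i == j)%:R * p i + (value i + value j == 0)%:R * p i +
   (value j == 0)%:R * p i + (value i == 0)%:R * p j)))).
  apply: ler_sum => i _; apply: ler_sum => j _.
  have pi : pind q (edges u v N (value i) :|: edges u v N (value j)) <= p i.
    by apply: (pind_subset q01); apply: finset.subsetUl.
  have pj : pind q (edges u v N (value i) :|: edges u v N (value j)) <= p j.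
    by apply: (pind_subset q01); apply: finset.subsetUr.
  have BB : 0 <= expR (9 * b) * (B i * B j) by rewrite !mulr_ge0 ?expR_ge0.
  have := p0 i; have := p0 j.
  have := @pind_valueU_upper i j q8; rewrite -/(B i) -/(B j).
  move: (pind q (_ :|: _)) (expR (9 * b) * _) pi pj BB.
  move=> P E Pi Pj E0 PE p0j p0i.
  move: PE; case: (i == j); case: (value i + value j == 0);
    case: (value j == 0); case: (value i == 0);
    rewrite ?andbF ?mul0r ?mul1r /=; lra.
under eq_bigr => i _ do rewrite big_split /=.
rewrite big_split /=; apply: lerD.
  rewrite le_eqVlt; apply/orP; left; apply/eqP.
  rewrite expr2 /height_sum mulr_suml mulr_sumr; apply: eq_bigr => i _.
  by rewrite !mulr_sumr.
have row (P : rel 'I_K) : (forall i j k, P i j -> P i k -> j = k) ->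
    \sum_i \sum_j (P i j)%:R * p i <= Ex q missing.
  move=> hP; rewrite Ex_missing; apply: ler_sum => i _.
  by rewrite -mulr_suml ler_piMl // sum_at_most_one //; apply: hP.
have r1 : \sum_i \sum_j (i == j)%:R * p i <= Ex q missing.
  by apply: row => i j k /eqP <- /eqP <-.
have r2 : \sum_i \sum_j (value i + value j == 0)%:R * p i <= Ex q missing.
  apply: (row (fun i j => value i + value j == 0)) => i j k.
  by rewrite ![value i + _]addrC !addr_eq0; apply: value_inj.
have r3 : \sum_i \sum_j (value j == 0)%:R * p i <= Ex q missing.
  by apply: (row (fun i j => value j == 0)) => i j k; apply: value_inj.
have r4 : \sum_i \sum_j (value i == 0)%:R * p j <= Ex q missing.
  by rewrite exchange_big /=.
under eq_bigr => i _ do rewrite !big_split /=.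
by rewrite !big_split /=; lra.
Qed.

Lemma missing_deviation (L : R) : 8 * q <= 1 -> 0 <= L ->
  Ex q (fun A => (q ^+ 2 * missing A - L) ^+ 2) <=
    expR (9 * b) * (q ^+ 2 * height_sum b) ^+ 2 +
    4 * q ^+ 2 * (expR (4 * b) * (q ^+ 2 * height_sum b) + q ^+ 2) -
    2 * L * ((1 - q) * (expR (- (3 * a)) * (q ^+ 2 * height_sum a)) - q ^+ 2)
    + L ^+ 2.
Proof.
move=> q8 L0; have [q0 q1] := andP q01.
have q20 : 0 <= q ^+ 2 by rewrite exprn_ge0.
have q4 : 4 * q ^+ 2 < 1.
  by have := ler_wpM2l q0 q8; lra.
have -> : Ex q (fun A => (q ^+ 2 * missing A - L) ^+ 2) =
    q ^+ 2 * q ^+ 2 * Ex q (fun A => missing A ^+ 2) -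
    2 * L * q ^+ 2 * Ex q missing + L ^+ 2.
  rewrite -mulNr -!ExZ -ExD -[X in _ + X](Ex_cst q N) -ExD; apply: eq_Ex => A.
  by ring.
have := ler_wpM2l (mulr_ge0 q20 q20) (Ex_missing2_upper q8).
have := ler_wpM2l (mulr_ge0 q20 q20) (Ex_missing_upper q8).
have := ler_wpM2l (mulr_ge0 L0 q20) (Ex_missing_lower q4).
by lra.
Qed.

End Missing.

(** * Coincidences *)

(* An element that is not the chosen representative of its fibre collides with
   that representative. *)
Lemma card_le_image_collisions (T : finType) (K : eqType) (h : T -> K)
    (P : {set T}) (s : seq K) : {in P, forall e, h e \in s} ->
  (#|P| <= size s + #|[set t : T * T | [&& t.1 \in P, t.2 \in P,
     t.1 != t.2 & h t.1 == h t.2]]|)%N.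
Proof.
move=> hs; pose rep e := odflt e [pick e' in P | h e' == h e].
have repP e : e \in P -> rep e \in P /\ h (rep e) = h e.
  rewrite /rep; case: pickP => [e' /andP[-> /eqP ->]//|/(_ e)].
  by rewrite eqxx andbT => ->.
have rep_eq e e' : e \in P -> h e = h e' -> rep e = rep e'.
  move=> eP he; rewrite /rep -he; case: pickP => // /(_ e).
  by rewrite eqxx andbT eP.
rewrite -(cardsID [set e | rep e == e] P); apply: leq_add.
  rewrite cardE -(size_map h); apply: uniq_leq_size.
    rewrite map_inj_in_uniq ?enum_uniq // => a b.
    rewrite !mem_enum !inE => /andP[aP /eqP ra] /andP[bP /eqP rb] hab.
    by rewrite -ra -rb; exact: rep_eq.
  by move=> k /mapP[e]; rewrite mem_enum inE => /andP[eP _] ->; exact: hs.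
rewrite -(card_in_imset (f := fun e => (e, rep e))); last by move=> a b _ _ [].
apply/subset_leq_card/fintype.subsetP => t /imsetP[e].
rewrite !inE eq_sym => /andP[re eP] ->; have [rP hr] := repP _ eP.
by rewrite /= eP rP re hr eqxx.
Qed.

Section Collisions.
Variables (u v : int) (N : nat).
Hypotheses (u_neq0 : u != 0) (v_neq0 : v != 0) (uv : u != v).
Local Notation I := 'I_N.+1.
Local Notation f e := (linform u v ((e : I * I).1 : nat)%:Z (e.2 : nat)%:Z).

Definition collisions : {set (I * I) * (I * I)} :=
  [set t | [&& t.1.1 != t.1.2, t.2.1 != t.2.2, t.1 != t.2 & f t.1 == f t.2]].

Definition vertices (t : (I * I) * (I * I)) : {set I} :=
  [set z in [:: t.1.1; t.1.2; t.2.1; t.2.2]].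

Lemma card_form_image_le (A : {set I}) :
  (#|` form_image (linform u v) A|%fset <= #|A| ^ 2)%N.
Proof.
rewrite -mulnn -cardsX cardE -(size_map (fun e : I * I => f e)).
apply: uniq_leq_size; first exact: fset_uniq.
move=> k /imfset2P[x xA [y yA ->]]; apply/mapP; exists (x, y) => //.
by rewrite mem_enum inE /= xA yA.
Qed.

Lemma card_form_image_ge (A : {set I}) :
  (#|A| ^ 2 <= #|` form_image (linform u v) A|%fset + #|A| +
     #|[set t in collisions | vertices t \subset A]|)%N.
Proof.
set P := [set e in finset.setX A A | e.1 != e.2].
have cP : (#|A| ^ 2 <= #|P| + #|A|)%N.
  rewrite -mulnn -cardsX -(cardsID [set e | e.1 == e.2]) addnC.
  apply: leq_add.
    by apply/subset_leq_card/fintype.subsetP => e; rewrite !inE andbC.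
  rewrite -(card_in_imset (f := fst)); last first.
    move=> [a b] [c d]; rewrite !inE /= => /andP[_ /eqP <-] /andP[_ /eqP <-].
    by move=> ->.
  by apply/subset_leq_card/fintype.subsetP => x /imsetP[e];
    rewrite !inE => /andP[/andP[xA _] _] ->.
have := @card_le_image_collisions _ _ (fun e : I * I => f e) P
  (form_image (linform u v) A).
move=> H; apply: leq_trans cP _; rewrite addnAC leq_add2r.
apply: leq_trans (H _) _.
  move=> [x y]; rewrite !inE /= => /andP[/andP[xA yA] _].
  by apply/imfset2P; exists x => //; exists y.
rewrite leq_add2l; apply/subset_leq_card/fintype.subsetP => -[[a b] [c d]].
rewrite !inE /= => /and4P[/andP[/andP[aA bA] ab] /andP[/andP[cA dA] cd] -> ->].
rewrite ab cd /=; apply/fintype.subsetP => z.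
by rewrite !inE => /or4P[] /eqP ->.
Qed.

Lemma collision_coords t : t \in collisions ->
  [/\ t.1.1 != t.1.2, t.2.1 != t.2.2, t.1.1 != t.2.1, t.1.2 != t.2.2 &
    (t.1.2 == t.2.1) && (t.1.1 == t.2.2) = false].
Proof.
case: t => [[x y] [x' y']]; rewrite !inE /= => /and4P[xy xy' ne /eqP fE].
split => //.
- apply: contra ne => /eqP xx; move: fE; rewrite xx.
  by move=> /(linform_injr v_neq0)[/val_inj ->].
- apply: contra ne => /eqP yy; move: fE; rewrite yy.
  by move=> /(linform_injl u_neq0)[/val_inj ->].
apply/negP => /andP[/eqP yx /eqP xy1].
move: fE; rewrite -yx -xy1 /linform => fE.
have /eqP : (u - v) * ((x : nat)%:Z - (y : nat)%:Z) = 0 by lia.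
rewrite mulf_eq0 subr_eq0 (negbTE uv) /= subr_eq0 => /eqP[/val_inj xyE].
by rewrite xyE eqxx in xy.
Qed.

Lemma card_vertices3 t : t \in collisions -> (3 <= #|vertices t|)%N.
Proof.
case/collision_coords; case: t => [[x y] [x' y']] /= xy xy' xx yy ne.
apply/card_gt2P; have [yx|yx] := eqVneq y x'.
  exists x, y, y'; rewrite !inE !eqxx !orbT; split => //; split => //.
  by move: ne; rewrite yx eqxx /= eq_sym => ->.
exists x, y, x'; rewrite !inE !eqxx !orbT; split => //; split => //.
by rewrite eq_sym.
Qed.

Lemma card_vertices4 t : t \in collisions -> t.1.2 != t.2.1 -> t.1.1 != t.2.2 ->
  #|vertices t| = 4%N.
Proof.
case/collision_coords; case: t => [[x y] [x' y']] /= xy xy' xx yy _ yx xy1.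
rewrite cardsE; apply/card_uniqP => /=.
by rewrite !inE !negb_or xy xx xy1 yx yy xy'.
Qed.

Lemma card_collisions : (#|collisions| <= N.+1 ^ 3)%N.
Proof.
rewrite -(card_in_imset (f := fun t => (t.1, t.2.1))); last first.
  move=> [[x y] [x' y']] [[a b] [a' b']]; rewrite !inE /=.
  move=> /and4P[_ _ _ /eqP h] /and4P[_ _ _ /eqP h'] [xa yb xa'].
  move: h'; rewrite -xa -yb -xa' h => /(linform_injr v_neq0)[/val_inj ->].
  by [].
apply: leq_trans (max_card _) _; rewrite !card_prod !card_ord.
by rewrite !expnS expn0 muln1 mulnA.
Qed.

Lemma card_collisions_mid :
  (#|[set t in collisions | t.1.2 == t.2.1]| <= N.+1 ^ 2)%N.
Proof.
rewrite -(card_in_imset (f := fst)); last first.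
  move=> [[x y] [x' y']] [[a b] [a' b']]; rewrite !inE /=.
  move=> /andP[/and4P[_ _ _ /eqP h] /eqP yx'].
  move=> /andP[/and4P[_ _ _ /eqP h'] /eqP ba'].
  move=> [xa yb]; move: h'; rewrite -ba' -xa -yb h -yx'.
  by move=> /(linform_injr v_neq0)[/val_inj ->].
by apply: leq_trans (max_card _) _; rewrite card_prod !card_ord mulnn.
Qed.

Lemma card_collisions_ends :
  (#|[set t in collisions | t.1.1 == t.2.2]| <= N.+1 ^ 2)%N.
Proof.
rewrite -(card_in_imset (f := fst)); last first.
  move=> [[x y] [x' y']] [[a b] [a' b']]; rewrite !inE /=.
  move=> /andP[/and4P[_ _ _ /eqP h] /eqP yx'].
  move=> /andP[/and4P[_ _ _ /eqP h'] /eqP ba'].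
  move=> [xa yb]; move: h'; rewrite -ba' -xa -yb h -yx'.
  by move=> /(linform_injl u_neq0)[/val_inj ->].
by apply: leq_trans (max_card _) _; rewrite card_prod !card_ord mulnn.
Qed.

Variables (R : realType) (q : R).
Hypothesis q01 : 0 <= q <= 1.

Lemma Ex_collisions :
  Ex q (fun A => #|[set t in collisions | vertices t \subset A]|%:R) <=
    N.+1%:R ^+ 3 * q ^+ 4 + 2 * N.+1%:R ^+ 2 * q ^+ 3.
Proof.
have [q0 q1] := andP q01.
have count (P : pred ((I * I) * (I * I))) :
    #|[set t in collisions | P t]|%:R = \sum_(t in collisions) (P t)%:R :> R.
  by rewrite -natr_sum -sum1dep_card big_mkcondr; congr _%:R.
under eq_Ex do rewrite count.
rewrite Ex_sum; under eq_bigr do rewrite Ex_superset.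
apply: (@le_trans _ _ (\sum_(t in collisions) (q ^+ 4 +
    (t.1.2 == t.2.1)%:R * q ^+ 3 + (t.1.1 == t.2.2)%:R * q ^+ 3))).
  apply: ler_sum => t tC.
  have q3 : q ^+ #|vertices t| <= q ^+ 3.
    by rewrite ler_wiXn2l // card_vertices3.
  have q30 : 0 <= q ^+ 3 by rewrite exprn_ge0.
  have q40 : 0 <= q ^+ 4 by rewrite exprn_ge0.
  have := card_vertices4 tC.
  case: (t.1.2 == _); case: (t.1.1 == _); rewrite /= ?mul1r ?mul0r.
  - by move=> _; lra.
  - by move=> _; lra.
  - by move=> _; lra.
  - by move=> -> //; rewrite !addr0.
rewrite !big_split /= -!mulr_suml -!count sumr_const -mulr_natl.
have c4 : #|collisions|%:R <= N.+1%:R ^+ 3 :> R.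
  by rewrite -natrX ler_nat card_collisions.
have c3 : #|[set t in collisions | t.1.2 == t.2.1]|%:R <= N.+1%:R ^+ 2 :> R.
  by rewrite -natrX ler_nat card_collisions_mid.
have c3' : #|[set t in collisions | t.1.1 == t.2.2]|%:R <= N.+1%:R ^+ 2 :> R.
  by rewrite -natrX ler_nat card_collisions_ends.
have := ler_wpM2r (exprn_ge0 4 q0) c4; have := ler_wpM2r (exprn_ge0 3 q0) c3.
by have := ler_wpM2r (exprn_ge0 3 q0) c3'; lra.
Qed.

End Collisions.

Section Size.
Variables (R : realType) (q : R) (N : nat).

Lemma card_sum (A : {set 'I_N.+1}) :
  #|A|%:R = \sum_(x < N.+1) (x \in A)%:R :> R.
Proof.
by rewrite -natr_sum -sum1_card big_mkcond; congr _%:R.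
Qed.

Lemma Ex_card : Ex q (fun A : {set 'I_N.+1} => #|A|%:R) = N.+1%:R * q.
Proof.
under eq_Ex do rewrite card_sum.
rewrite Ex_sum (eq_bigr (fun=> q)) => [|x _].
  by rewrite sumr_const card_ord -[LHS]mulr_natl.
rewrite -[RHS]expr1 -(cards1 x) -Ex_superset; apply: eq_Ex => A.
by rewrite finset.sub1set.
Qed.

Lemma Ex_card2 :
  Ex q (fun A : {set 'I_N.+1} => #|A|%:R ^+ 2) = N.+1%:R * (q + N%:R * q ^+ 2).
Proof.
under eq_Ex do rewrite card_sum expr2 mulr_suml.
rewrite Ex_sum (eq_bigr (fun=> q + N%:R * q ^+ 2)) => [|x _].
  by rewrite sumr_const card_ord -[LHS]mulr_natl.
under eq_Ex do rewrite mulr_sumr.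
have pair y : Ex q (fun A : {set 'I_N.+1} => (x \in A)%:R * (y \in A)%:R) =
    q ^+ (x != y).+1.
  rewrite -cards2 -Ex_superset; apply: eq_Ex => A.
  by rewrite finset.subUset !finset.sub1set -mulnb natrM.
rewrite Ex_sum (bigD1 x) //= pair eqxx expr1; congr (_ + _).
rewrite (eq_bigr (fun=> q ^+ 2)) => [|y yx]; last by rewrite pair eq_sym yx.
rewrite sumr_const -[LHS]mulr_natl; congr (_%:R * _).
by transitivity #|predC1 x|; [apply: eq_card|rewrite cardC1 card_ord].
Qed.

Lemma Ex_card_deviation :
  Ex q (fun A : {set 'I_N.+1} => (#|A|%:R - N%:R * q) ^+ 2) =
    N.+1%:R * q - N%:R * q ^+ 2.
Proof.
transitivity (Ex q (fun A : {set 'I_N.+1} => #|A|%:R ^+ 2) +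
    - (2 * (N%:R * q)) * Ex q (fun A : {set 'I_N.+1} => #|A|%:R) +
    (N%:R * q) ^+ 2).
  by rewrite -ExZ -ExD -[X in _ + X](Ex_cst q N) -ExD; apply: eq_Ex => A; ring.
by rewrite Ex_card Ex_card2 -natr1; ring.
Qed.

End Size.

(** * Limits *)

Local Open Scope classical_set_scope.
Local Open Scope ring_scope.

Section HeightSum.
Variables (R : realType) (u v : int).
Hypotheses (u_gt0 : 0 < u) (v_neq0 : v != 0) (vu : `|v| <= u).
Local Notation U := `|u|%N.
Local Notation W := `|v|%N.

Lemma height_sum_geometric (N : nat) (x : R) :
  let Q := expR (- (x / (U * W)%:R)) in
  height_sum u v N x =
    2 * (\sum_(i < W * N) Q ^+ i) + ((U - W) * N).+1%:R * Q ^+ (W * N).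
Proof.
move=> Q; have WU : (W <= U)%N by lia.
have term (i : nat) : expR (- (x * (i%:R / (U * W)%:R))) = Q ^+ i.
  by rewrite /Q -expRM_natl; congr expR; ring.
have UN : (W * N <= U * N)%N by rewrite leq_mul2r WU orbT.
rewrite /height_sum; under eq_bigr => i _ do rewrite term.
rewrite -(big_mkord xpredT (fun i => Q ^+ trapezoid u v N i)).
rewrite (@big_cat_nat _ _ _ (W * N)%N) //=; last by rewrite mulnDl; lia.
rewrite [X in _ + X](@big_cat_nat _ _ _ (U * N).+1%N) /=;
  [|by lia|by rewrite mulnDl; lia].
have -> : \sum_(0 <= i < W * N) Q ^+ trapezoid u v N i =
    \sum_(i < W * N) Q ^+ i.
  rewrite big_mkord; apply: eq_bigr => i _; congr (_ ^+ _).
  by rewrite /trapezoid mulnDl; have := ltn_ord i; lia.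
have -> : \sum_(W * N <= i < (U * N).+1) Q ^+ trapezoid u v N i =
    ((U - W) * N).+1%:R * Q ^+ (W * N).
  rewrite (eq_big_nat _ _ (F2 := fun=> Q ^+ (W * N))) => [|i hi].
    rewrite big_const_nat iter_addr_0 -[LHS]mulr_natl; congr (_%:R * _).
    by rewrite mulnBl; lia.
  by congr (_ ^+ _); rewrite /trapezoid mulnDl; lia.
have -> : \sum_((U * N).+1 <= i < ((U + W) * N).+1) Q ^+ trapezoid u v N i =
    \sum_(i < W * N) Q ^+ i.
  rewrite -{1}[(U * N).+1]add0n big_addn.
  have -> : (((U + W) * N).+1 - (U * N).+1 = W * N)%N by rewrite mulnDl; lia.
  rewrite big_mkord (reindex_inj rev_ord_inj); apply: eq_bigr => i _.
  by congr (_ ^+ _); rewrite /trapezoid mulnDl /=; have := ltn_ord i; lia.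
by ring.
Qed.

Lemma height_sum_closed (N : nat) (x : R) : 0 < x ->
  height_sum u v N x =
    2 * (1 - expR (- (x * N%:R / U%:R))) / (1 - expR (- (x / (U * W)%:R))) +
    ((U - W)%:R * N%:R + 1) * expR (- (x * N%:R / U%:R)).
Proof.
move=> x0; rewrite height_sum_geometric.
have U0 : 0 < U%:R :> R by rewrite ltr0n; lia.
have W0 : 0 < W%:R :> R by rewrite ltr0n; lia.
set Q := expR (- (x / (U * W)%:R)).
have -> : expR (- (x * N%:R / U%:R)) = Q ^+ (W * N).
  rewrite /Q -expRM_natl; congr expR; rewrite !natrM; field.
  by rewrite !lt0r_neq0.
have Q1 : 1 - Q != 0.
  rewrite subr_eq0 gt_eqF // -expR0 ltr_expR oppr_lt0 divr_gt0 //.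
  by rewrite natrM mulr_gt0.
congr (_ + _); last by rewrite -addn1 natrD natrM.
rewrite -mulrA; congr (_ * _).
have := subrX1 Q (W * N); move: (\sum_(i < _) _) => S QS.
by rewrite (_ : 1 - Q ^+ _ = (1 - Q) * S) 1?mulrC ?mulKf //; lra.
Qed.

End HeightSum.

Section Limits.
Variable R : realType.
Implicit Types (p x z : nat -> R).

Lemma one_sub_expR_ratio_cvg z : (\forall N \near \oo, 0 < z N) ->
  z @ \oo --> (0 : R) ->
  (fun N => (1 - expR (- z N)) / z N) @ \oo --> (1 : R).
Proof.
move=> z0 z_cvg; apply: (@squeeze_cvgr _ _ _ _ (fun N => 1 - z N) (fun=> 1)).
- near=> N; have zN : 0 < z N by near: N.
  rewrite ler_pdivlMr // ler_pdivrMr //.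
  have := expRN_le_quadratic (ltW zN); have := expR_ge1Dx (- z N).
  by move=> ? ?; apply/andP; split; lra.
- by rewrite -[X in _ --> X]subr0; apply: cvgB => //; apply: cvg_cst.
- exact: cvg_cst.
Unshelve. all: by end_near. Qed.

Lemma sqr_cvg0 p : p @ \oo --> (0 : R) -> (fun N => p N ^+ 2) @ \oo --> (0 : R).
Proof. by move=> p0; rewrite -[X in _ --> X](mulr0 0); apply: cvgM. Qed.

Lemma height_sum_cvg (u v : int) p x (theta kappa : R) :
  0 < u -> v != 0 -> `|v| <= u -> (forall N, 0 < p N) -> p @ \oo --> (0 : R) ->
  (\forall N \near \oo, 0 < x N) ->
  (fun N => x N / p N ^+ 2) @ \oo --> (1 : R) ->
  (fun N => expR (- (x N * N%:R / `|u|%N%:R))) @ \oo --> theta ->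
  (fun N => N%:R * p N ^+ 2 * expR (- (x N * N%:R / `|u|%N%:R))) @ \oo -->
    kappa ->
  (fun N => p N ^+ 2 * height_sum u v N (x N)) @ \oo -->
    2 * (`|u| * `|v|)%N%:R * (1 - theta) + (`|u| - `|v|)%N%:R * kappa.
Proof.
move=> u0 v0 vu p0 pc x0 xp Et Ek.
have UW0 : 0 < (`|u| * `|v|)%N%:R :> R.
  by rewrite ltr0n muln_gt0 !absz_gt0 v0 gt_eqF.
set UW := (`|u| * `|v|)%N%:R in UW0 *.
have p2c := sqr_cvg0 pc.
have xc : x @ \oo --> (0 : R).
  rewrite -(mulr0 1); apply: cvg_trans (cvgM xp p2c).
  apply: near_eq_cvg; near=> N => /=.
  by rewrite mulfVK // expf_neq0 // gt_eqF.
pose z N := x N / UW.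
have z0 : \forall N \near \oo, 0 < z N.
  by near=> N; rewrite divr_gt0 //; near: N.
have zc : z @ \oo --> (0 : R).
  by rewrite -(mul0r UW^-1); apply: cvgM => //; apply: cvg_cst.
have zr := one_sub_expR_ratio_cvg z0 zc.
pose E N := expR (- (x N * N%:R / `|u|%N%:R)).
have -> : 2 * UW * (1 - theta) + (`|u| - `|v|)%N%:R * kappa =
    (2 * UW * (1 - theta) * (1^-1 * 1^-1) + (`|u| - `|v|)%N%:R * kappa) +
    0 * theta by rewrite invr1; ring.
apply: cvg_trans (cvgD (cvgD (cvgM (cvgM (cvg_cst (2 * UW))
  (cvgB (cvg_cst (1 : R)) Et)) (cvgM (cvgV (oner_neq0 R) xp)
  (cvgV (oner_neq0 R) zr))) (cvgM (cvg_cst ((`|u| - `|v|)%N%:R : R)) Ek))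
  (cvgM p2c Et)).
apply: near_eq_cvg; near=> N => /=.
have xN : 0 < x N by near: N.
rewrite height_sum_closed // -/UW -/(z N) -/(E N).
have zN : 0 < z N by rewrite divr_gt0.
have eN : 1 - expR (- z N) != 0.
  by rewrite subr_eq0 gt_eqF // -expR0 ltr_expR oppr_lt0.
rewrite -[LHS]/(2 * UW * (1 - E N) * ((x N / p N ^+ 2)^-1 *
    ((1 - expR (- z N)) / z N)^-1) +
  (`|u| - `|v|)%N%:R * (N%:R * p N ^+ 2 * E N) + p N ^+ 2 * E N).
have -> : x N = z N * UW by rewrite mulfVK // gt_eqF.
field; rewrite eN !gt_eqF // ltr0n absz_gt0 // gt_eqF //.
Unshelve. all: by end_near. Qed.

Lemma ratio_lower_cvg p : p @ \oo --> (0 : R) -> (forall N, 0 < p N) ->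
  (fun N => p N ^+ 2 / (1 - 4 * p N ^+ 2) / p N ^+ 2) @ \oo --> (1 : R).
Proof.
move=> pc p0.
have c : (fun N => (1 - 4 * p N ^+ 2)^-1) @ \oo --> (1 - 4 * 0 : R)^-1.
  apply: cvgV; first by rewrite mulr0 subr0 oner_neq0.
  apply: cvgB; first exact: cvg_cst.
  by apply: cvgM; [exact: cvg_cst|exact: sqr_cvg0].
rewrite mulr0 subr0 invr1 in c; apply: cvg_trans c; apply: near_eq_cvg.
near=> N => /=; rewrite mulrAC divff ?mul1r // expf_neq0 // gt_eqF //.
Unshelve. all: by end_near. Qed.

Lemma ratio_upper_cvg p : p @ \oo --> (0 : R) -> (forall N, 0 < p N) ->
  (fun N => p N ^+ 2 * (1 - 8 * p N) / p N ^+ 2) @ \oo --> (1 : R).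
Proof.
move=> pc p0.
have c : (fun N => 1 - 8 * p N) @ \oo --> (1 - 8 * 0 : R).
  apply: cvgB; first exact: cvg_cst.
  by apply: cvgM; [exact: cvg_cst|].
rewrite mulr0 subr0 in c; apply: cvg_trans c; apply: near_eq_cvg.
near=> N => /=; rewrite mulrAC divff ?mul1r // expf_neq0 // gt_eqF //.
Unshelve. all: by end_near. Qed.

Lemma cvg0_pos_lt p (e : R) : p @ \oo --> (0 : R) -> 0 < e ->
  \forall N \near \oo, p N < e.
Proof. by move=> pc e0; apply: (cvgr_lt 0 pc). Qed.

(* x stands for either of the two exponents p^2 (1 + O(p)) that bound the
   probability of a missing value from below and from above. *)
Definition exp_profile p (u : int) (theta kappa : R) : Prop :=
  forall x, (\forall N \near \oo, 0 < x N) ->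
  (fun N => x N / p N ^+ 2) @ \oo --> (1 : R) ->
  (fun N => expR (- (x N * N%:R / `|u|%N%:R))) @ \oo --> theta /\
  (fun N => N%:R * p N ^+ 2 * expR (- (x N * N%:R / `|u|%N%:R))) @ \oo -->
    kappa.

Lemma missing_deviation_cvg (u v : int) p (theta kappa : R) :
  0 < u -> v != 0 -> u != v -> `|v| <= u -> gcdz u v = 1 ->
  (forall N, 0 < p N < 1) -> p @ \oo --> (0 : R) ->
  exp_profile p u theta kappa ->
  let L := 2 * (`|u| * `|v|)%N%:R * (1 - theta) + (`|u| - `|v|)%N%:R * kappa in
  0 <= L ->
  (fun N => Ex (p N) (fun A : {set 'I_N.+1} =>
    (p N ^+ 2 * missing R u v A - L) ^+ 2)) @ \oo --> (0 : R).
Proof.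
move=> u0 v0 uv vu guv p01 pc prof L L0.
have p0 N : 0 < p N by have /andP[] := p01 N.
pose a N := p N ^+ 2 / (1 - 4 * p N ^+ 2).
pose b N := p N ^+ 2 * (1 - 8 * p N).
have p8 : \forall N \near \oo, 8 * p N < 1.
  have e0 : 0 < 1 / 8 :> R by lra.
  near=> N; have : p N < 1 / 8 by near: N; exact: cvg0_pos_lt.
  by lra.
have p4 : \forall N \near \oo, 4 * p N ^+ 2 < 1.
  near=> N; have p8N : 8 * p N < 1 by near: N.
  by have := ler_wpM2l (ltW (p0 N)) (ltW p8N); have := p0 N; lra.
have a0 : \forall N \near \oo, 0 < a N.
  near=> N; have : 4 * p N ^+ 2 < 1 by near: N.
  by move=> ?; rewrite divr_gt0 ?exprn_gt0 // subr_gt0.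
have b0 : \forall N \near \oo, 0 < b N.
  near=> N; have : 8 * p N < 1 by near: N.
  by move=> ?; rewrite mulr_gt0 ?exprn_gt0 // subr_gt0.
have ar : (fun N => a N / p N ^+ 2) @ \oo --> (1 : R) by exact: ratio_lower_cvg.
have br : (fun N => b N / p N ^+ 2) @ \oo --> (1 : R) by exact: ratio_upper_cvg.
have [at_ ak] := prof _ a0 ar; have [bt bk] := prof _ b0 br.
have ha := height_sum_cvg u0 v0 vu p0 pc a0 ar at_ ak.
have hb := height_sum_cvg u0 v0 vu p0 pc b0 br bt bk.
rewrite -/L in ha hb.
have p2c := sqr_cvg0 pc.
have scaled_exp x (k : R) : (fun N => x N / p N ^+ 2) @ \oo --> (1 : R) ->
    (fun N => expR (k * x N)) @ \oo --> (1 : R).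
  move=> xr; rewrite -(expR0 R).
  apply: (continuous_cvg _ (@continuous_expR R _)).
  rewrite -[X in _ --> X](mulr0 k); apply: cvgM; first exact: cvg_cst.
  rewrite -[X in _ --> X](mulr0 1); apply: cvg_trans (cvgM xr p2c).
  apply: near_eq_cvg; near=> N => /=.
  by rewrite mulfVK // expf_neq0 // gt_eqF.
have hb2 : (fun N => (p N ^+ 2 * height_sum u v N (b N)) ^+ 2) @ \oo --> L ^+ 2.
  by apply: cvgM.
have c : (fun N => expR (9 * b N) * (p N ^+ 2 * height_sum u v N (b N)) ^+ 2 +
    4 * p N ^+ 2 * (expR (4 * b N) * (p N ^+ 2 * height_sum u v N (b N)) +
      p N ^+ 2) -
    2 * L * ((1 - p N) * (expR (- 3 * a N) *
      (p N ^+ 2 * height_sum u v N (a N))) - p N ^+ 2) + L ^+ 2) @ \oo -->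
    1 * L ^+ 2 + 4 * 0 * (1 * L + 0) - 2 * L * ((1 - 0) * (1 * L) - 0) + L ^+ 2.
  apply: cvgD; last exact: cvg_cst.
  apply: cvgB.
    apply: cvgD; first by apply: cvgM => //; exact: scaled_exp.
    apply: cvgM; first by apply: cvgM => //; exact: cvg_cst.
    by apply: cvgD => //; apply: cvgM => //; exact: scaled_exp.
  apply: cvgM; first exact: cvg_cst.
  apply: cvgB => //; apply: cvgM; first by apply: cvgB => //; exact: cvg_cst.
  by apply: cvgM => //; exact: scaled_exp.
have L00 : 1 * L ^+ 2 + 4 * 0 * (1 * L + 0) -
    2 * L * ((1 - 0) * (1 * L) - 0) + L ^+ 2 = 0.
  by ring.
rewrite L00 in c.
apply: (@squeeze_cvgr _ _ _ _ (fun=> 0) _ _ _ _ (cvg_cst _) c).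
near=> N; have pN : 0 <= p N <= 1 by have /andP[/ltW -> /ltW ->] := p01 N.
have p8N : 8 * p N <= 1 by apply: ltW; near: N.
apply/andP; split; first by apply: Ex_ge0 => // A; rewrite exprn_even_ge0.
have := missing_deviation N u0 v0 uv vu guv pN p8N L0.
by rewrite -/(a N) -/(b N) mulNr.
Unshelve. all: by end_near. Qed.

Lemma prob_sim_of_missing (u v : int) p (L : R)
    (X : forall N : nat, {set 'I_N.+1} -> R) (F : nat -> R) :
  (forall N, 0 < p N < 1) ->
  (fun N => Ex (p N) (fun A : {set 'I_N.+1} =>
    (p N ^+ 2 * missing R u v A - L) ^+ 2)) @ \oo --> (0 : R) ->
  (forall e, 0 < e -> exists2 d, 0 < d & \forall N \near \oo,
     forall A : {set 'I_N.+1}, X N A \notin `[(1 - e) * F N, (1 + e) * F N] ->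
       d <= `|p N ^+ 2 * missing R u v A - L|) ->
  prob_sim p X F.
Proof.
move=> p01 c hX e1 e2 e10 e20; have [d d0 hd] := hX _ e10.
have : \forall N \near \oo, Pr (p N) [set A : {set 'I_N.+1} |
    X N A \notin `[(1 - e1) * F N, (1 + e1) * F N]] < e2.
  have e2d : 0 < e2 * d ^+ 2 by rewrite mulr_gt0 ?exprn_gt0.
  have := cvg0_pos_lt c e2d => c'.
  near=> N; have pN : 0 <= p N <= 1 by have /andP[/ltW -> /ltW ->] := p01 N.
  have dN : forall A : {set 'I_N.+1},
      X N A \notin `[(1 - e1) * F N, (1 + e1) * F N] ->
       d <= `|p N ^+ 2 * missing R u v A - L| by near: N.
  have d20 : 0 < d ^+ 2 by rewrite exprn_gt0.
  apply: le_lt_trans (markov_Pr pN d20 (F := fun A : {set 'I_N.+1} =>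
    (p N ^+ 2 * missing R u v A - L) ^+ 2) _ _) _.
  - by move=> A; rewrite exprn_even_ge0.
  - move=> A; rewrite inE => /dN dA.
    by rewrite -[leRHS]real_normK ?num_real // lerXn2r ?nnegrE // ltW.
  - by rewrite ltr_pdivrMr //; near: N.
case=> N0 _ hN0; exists N0.+1 => // N N0N; apply: hN0 => /=.
by apply: leq_trans N0N; apply: ltnW.
Unshelve. all: by end_near. Qed.

End Limits.

Section LargeProbability.
Variable R : realType.
Implicit Types (p x : nat -> R) (u v : int).

Lemma sqr_powR_half (N : nat) : (N%:R `^ (- 2^-1)) ^+ 2 = N%:R^-1 :> R.
Proof. by rewrite powRN powR12_sqrt // exprVn sqr_sqrtr. Qed.

Lemma intr_absz u : 0 <= u -> u%:~R = `|u|%N%:R :> R.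
Proof. by move=> u0; rewrite pmulrn gez0_abs. Qed.

Lemma exp_profile_critical p u (c : R) : 0 < u -> (forall N, 0 < p N) ->
  (\forall N \near \oo, p N ^+ 2 * N%:R = c ^+ 2) ->
  exp_profile p u (expR (- (c ^+ 2 / `|u|%N%:R)))
    (c ^+ 2 * expR (- (c ^+ 2 / `|u|%N%:R))).
Proof.
move=> u0 p0 pN x x0 xr.
have t : (fun N => expR (- (x N * N%:R / `|u|%N%:R))) @ \oo -->
    expR (- (c ^+ 2 / `|u|%N%:R)).
  apply: (continuous_cvg _ (@continuous_expR R _)); apply: cvgN.
  rewrite -[c ^+ 2]mul1r; apply: cvgM; last exact: cvg_cst.
  apply: cvg_trans (cvgM xr (cvg_cst (c ^+ 2))); apply: near_eq_cvg.
  near=> N => /=; have <- : p N ^+ 2 * N%:R = c ^+ 2 by near: N.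
  by rewrite mulrA mulfVK // expf_neq0 // gt_eqF.
split => //; apply: cvg_trans (cvgM (cvg_cst (c ^+ 2)) t).
apply: near_eq_cvg; near=> N => /=; congr (_ * _).
by rewrite mulrC; apply/esym; near: N.
Unshelve. all: by end_near. Qed.

Lemma exp_profile_supercritical p u : 0 < u -> (forall N, 0 < p N) ->
  (fun N => (N%:R * p N ^+ 2)^-1) @ \oo --> (0 : R) ->
  exp_profile p u 0 0.
Proof.
move=> u0 p0 pN x x0 xr; set U := `|u|%N%:R.
have U0 : 0 < U by rewrite ltr0n absz_gt0 gt_eqF.
pose t N := x N * N%:R / U.
have t0 : \forall N \near \oo, 0 < t N.
  near=> N; rewrite divr_gt0 // mulr_gt0 //; first by near: N.
  by rewrite ltr0n; near: N; exact: nbhs_infty_gt.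
have ri : (fun N => (x N / p N ^+ 2)^-1) @ \oo --> (1 : R).
  by rewrite -[X in _ --> X]invr1; apply: cvgV.
split.
  apply: (@squeeze_cvgr _ _ _ _ (fun=> 0)
    (fun N => U * ((x N / p N ^+ 2)^-1 * (N%:R * p N ^+ 2)^-1))).
  - near=> N; rewrite expR_ge0 /= -/(t N).
    have tN : 0 < t N by near: N.
    have xN : 0 < x N by near: N.
    have N0 : 0 < N%:R :> R by rewrite ltr0n; near: N; exact: nbhs_infty_gt.
    apply: le_trans (expRN_le_inv (ltW tN)) _.
    have -> : U * ((x N / p N ^+ 2)^-1 * (N%:R * p N ^+ 2)^-1) = (t N)^-1.
      by rewrite /t; field; rewrite !gt_eqF.
    by rewrite lef_pV2 ?posrE //; lra.
  - exact: cvg_cst.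
  - rewrite -(mulr0 U); apply: cvgM; first exact: cvg_cst.
    by rewrite -(mulr0 1); apply: cvgM.
apply: (@squeeze_cvgr _ _ _ _ (fun=> 0)
    (fun N => 4 * U ^+ 2 * ((x N / p N ^+ 2)^-1 ^+ 2 * (N%:R * p N ^+ 2)^-1))).
- near=> N.
  rewrite !mulr_ge0 ?expR_ge0 ?exprn_ge0 ?ler0n ?(ltW (p0 N)) //= -/(t N).
  have tN : 0 < t N by near: N.
  have xN : 0 < x N by near: N.
  have N0 : 0 < N%:R :> R by rewrite ltr0n; near: N; exact: nbhs_infty_gt.
  have -> : 4 * U ^+ 2 * ((x N / p N ^+ 2)^-1 ^+ 2 * (N%:R * p N ^+ 2)^-1) =
      N%:R * p N ^+ 2 * ((t N / 2)^-1 ^+ 2).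
    by rewrite /t; field; rewrite !gt_eqF.
  rewrite ler_wpM2l ?mulr_ge0 ?exprn_ge0 ?(ltW (p0 N)) //.
  have -> : - t N = (- (t N / 2)) *+ 2 by rewrite mulr2n; field.
  rewrite -[X in expR X]mulr_natl expRM_natl.
  rewrite lerXn2r ?nnegrE ?expR_ge0 ?invr_ge0 //.
    by apply: divr_ge0 => //; exact: ltW.
  apply: le_trans (expRN_le_inv _) _; first by lra.
  by rewrite lef_pV2 ?posrE //; lra.
- exact: cvg_cst.
- rewrite -(mulr0 (4 * U ^+ 2)); apply: cvgM; first exact: cvg_cst.
  rewrite -(mulr0 (1 ^+ 2)); apply: cvgM => //.
  by apply: cvgM.
Unshelve. all: by end_near. Qed.

Lemma g_bounds u v (x : R) : v != 0 -> `|v| <= u -> 0 < x ->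
  0 < g u v x < (u + `|v|)%:~R.
Proof.
move=> v0 vu x0; rewrite /g intrD intrB.
have w0 : 0 < `|v|%:~R :> R by rewrite ltr0z normr_gt0.
have wu : `|v|%:~R <= u%:~R :> R by rewrite ler_int.
move: (`|v|%:~R) (u%:~R) w0 wu => w y w0 wy.
have e1 : expR (- x) < 1 by rewrite -expR0 ltr_expR oppr_lt0.
have r0 : 0 < (1 - expR (- x)) / x by rewrite divr_gt0 // subr_gt0.
have r1 : (1 - expR (- x)) / x < 1.
  rewrite ltr_pdivrMr // mul1r; have := @expR_gt1Dx R (- x).
  by rewrite oppr_eq0 gt_eqF // => /(_ isT); lra.
have := mulr_gt0 w0 r0.
have : w * ((1 - expR (- x)) / x) < w * 1 by rewrite ltr_pM2l.
move: ((1 - expR (- x)) / x) => r h2 h1.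
have : 0 <= (y - w) * (1 - expR (- x)) by rewrite mulr_ge0 // subr_ge0 // ltW.
have : 0 <= (y - w) * expR (- x) by rewrite mulr_ge0 ?expR_ge0 // subr_ge0.
by move=> h3 h4; apply/andP; split; lra.
Qed.

Lemma prob_sim_critical p u v (c : R) :
  0 < u -> v != 0 -> u != v -> `|v| <= u -> gcdz u v = 1 ->
  (forall N, 0 < p N < 1) -> p @ \oo --> (0 : R) -> 0 < c ->
  (\forall N \near \oo, p N = c * N%:R `^ (- 2^-1)) ->
  prob_sim p (fun N A => image_card R (linform u v) A)
    (fun N => g u v (c ^+ 2 / u%:~R) * N%:R).
Proof.
move=> u0 v0 uv vu guv p01 pc c0 pcE.
have p0 N : 0 < p N by have /andP[] := p01 N.
have U0 : 0 < `|u|%N%:R :> R by rewrite ltr0n absz_gt0 gt_eqF.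
have pN : \forall N \near \oo, p N ^+ 2 * N%:R = c ^+ 2.
  near=> N; have -> : p N = c * N%:R `^ (- 2^-1) by near: N.
  rewrite exprMn sqr_powR_half mulfVK //.
  by rewrite pnatr_eq0 -lt0n; near: N; exact: nbhs_infty_gt.
have c2 : 0 < c ^+ 2 by rewrite exprn_gt0.
set th := expR (- (c ^+ 2 / `|u|%N%:R)).
have th1 : th <= 1 by rewrite -expR0 ler_expR oppr_le0 divr_ge0 // ltW.
have th0 : 0 <= th by exact: expR_ge0.
have := missing_deviation_cvg u0 v0 uv vu guv p01 pc
  (exp_profile_critical u0 p0 pN).
rewrite /= -/th; set L := 2 * _ * (1 - th) + _ * (c ^+ 2 * th) => dev.
have L0 : 0 <= L.
  by rewrite addr_ge0 // !mulr_ge0 // ?subr_ge0 // ltW.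
have uR0 : 0 < u%:~R :> R by rewrite ltr0z.
have /andP[G0 _] := g_bounds v0 vu (divr_gt0 c2 uR0).
have {}dev := dev L0.
have GL : c ^+ 2 * g u v (c ^+ 2 / u%:~R) = c ^+ 2 * (`|u| + `|v|)%N%:R - L.
  rewrite /g /L; have -> : (u + `|v|)%:~R = (`|u| + `|v|)%N%:R :> R.
    by rewrite intr_absz; [congr _%:R; lia|lia].
  have -> : (u - `|v|)%:~R = (`|u| - `|v|)%N%:R :> R.
    by rewrite intr_absz; [congr _%:R; lia|lia].
  have -> : `|v|%:~R = `|v|%N%:R :> R by rewrite intr_absz.
  rewrite intr_absz ?(ltW u0) // -/th natrM.
  by field; rewrite !gt_eqF.
apply: prob_sim_of_missing p01 dev _ => e e0.
set G := g _ _ _ in G0 GL *.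
exists (e * (c ^+ 2 * G) / 2); first by rewrite divr_gt0 // !mulr_gt0.
near=> N => A; rewrite image_cardE //.
have pNc : p N ^+ 2 * N%:R = c ^+ 2 by near: N.
have p2 : p N ^+ 2 < e * (c ^+ 2 * G) / 2.
  near: N; apply: (cvg0_pos_lt (sqr_cvg0 pc)).
  by rewrite divr_gt0 // !mulr_gt0.
have p20 : 0 < p N ^+ 2 by rewrite exprn_gt0.
rewrite leNgt; apply: contra; rewrite ltr_distl => /andP[h1 h2].
rewrite in_itv /= -(ler_pM2l p20) -[X in _ && X](ler_pM2l p20).
have scale (k : R) : p N ^+ 2 * (k * (G * N%:R)) = k * (c ^+ 2 * G).
  by rewrite -pNc; ring.
rewrite !scale.
have -> : p N ^+ 2 * (((`|u| + `|v|) * N).+1%:R - missing R u v A) =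
    c ^+ 2 * (`|u| + `|v|)%N%:R + p N ^+ 2 - p N ^+ 2 * missing R u v A.
  by rewrite -pNc -natr1 natrM; ring.
by apply/andP; split; lra.
Unshelve. all: by end_near. Qed.

Lemma prob_sim_supercritical p u v :
  0 < u -> v != 0 -> u != v -> `|v| <= u -> gcdz u v = 1 ->
  (forall N, 0 < p N < 1) -> p @ \oo --> (0 : R) ->
  is_little_o (fun N => N%:R `^ (- 2^-1)) p ->
  prob_sim p (fun N A => image_cocard R u v A)
    (fun N => (2 * u * `|v|)%:~R / p N ^+ 2).
Proof.
move=> u0 v0 uv vu guv p01 pc lo.
have p0 N : 0 < p N by have /andP[] := p01 N.
have U0 : 0 < `|u|%N%:R :> R by rewrite ltr0n absz_gt0 gt_eqF.
have W0 : 0 < `|v|%N%:R :> R by rewrite ltr0n absz_gt0.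
have pN : (fun N => (N%:R * p N ^+ 2)^-1) @ \oo --> (0 : R).
  apply: cvg_trans (sqr_cvg0 lo); apply: near_eq_cvg; near=> N.
  by rewrite exprMn sqr_powR_half exprVn -invfM.
have := missing_deviation_cvg u0 v0 uv vu guv p01 pc
  (exp_profile_supercritical u0 p0 pN).
rewrite /= subr0 mulr1 mulr0 addr0; set L := 2 * _ => dev.
have L0 : 0 < L by rewrite mulr_gt0 // natrM mulr_gt0.
have {}dev := dev (ltW L0).
have -> : (2 * u * `|v|)%:~R = L.
  rewrite intr_absz; last by rewrite !mulr_ge0 // ltW.
  by rewrite /L !abszM absz_id -mulnA natrM.
apply: prob_sim_of_missing p01 dev _ => e e0.
exists (e * L / 2); first by rewrite divr_gt0 // mulr_gt0.
near=> N => A; rewrite /image_cocard image_cardE //.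
have p2 : p N ^+ 2 < e * L / 2.
  near: N; apply: (cvg0_pos_lt (sqr_cvg0 pc)).
  by rewrite divr_gt0 // mulr_gt0.
have p20 : 0 < p N ^+ 2 by rewrite exprn_gt0.
rewrite leNgt; apply: contra; rewrite ltr_distl => /andP[h1 h2].
rewrite in_itv /= [(1 - e) * _]mulrA [(1 + e) * _]mulrA.
rewrite ler_pdivrMr // ler_pdivlMr //.
have -> : (u + `|v|)%:~R * N%:R - (((`|u| + `|v|) * N).+1%:R - missing R u v A)
    = missing R u v A - 1.
  have -> : (u + `|v|)%:~R = (`|u| + `|v|)%N%:R :> R.
    by rewrite intr_absz; [congr _%:R; lia|lia].
  by rewrite -natr1 natrM; ring.
by apply/andP; split; lra.
Unshelve. all: by end_near. Qed.

End LargeProbability.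

Section SmallProbability.
Variables (R : realType) (u v : int).
Hypotheses (u_neq0 : u != 0) (v_neq0 : v != 0) (uv : u != v).

(* The factor 1 + 2 / e comes from
   |n^2 - mu^2| <= (n - mu)^2 + 2 mu |n - mu| and
   2 mu |n - mu| <= (e / 2) mu^2 + (2 / e) (n - mu)^2. *)
Definition size_defect (e mu : R) (N : nat) (A : {set 'I_N.+1}) : R :=
  (1 + 2 / e) * (#|A|%:R - mu) ^+ 2 + #|A|%:R +
  #|[set t in collisions u v N | vertices t \subset A]|%:R.

Lemma size_defect_ge0 (e mu : R) (N : nat) (A : {set 'I_N.+1}) : 0 < e ->
  0 <= size_defect e mu A.
Proof.
move=> e0; rewrite addr_ge0 // addr_ge0 // mulr_ge0 ?exprn_even_ge0 //.
by rewrite addr_ge0 // divr_ge0 // ltW.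
Qed.

Lemma size_defect_large (e mu : R) (N : nat) (A : {set 'I_N.+1}) : 0 < e ->
  image_card R (linform u v) A \notin `[(1 - e) * mu ^+ 2, (1 + e) * mu ^+ 2] ->
  e / 2 * mu ^+ 2 <= size_defect e mu A.
Proof.
move=> e0; rewrite leNgt; apply: contra.
rewrite /size_defect /image_card in_itv /=.
have := card_form_image_le u v A; have := card_form_image_ge u v A.
rewrite -(ler_nat R) !natrD natrX => ge; rewrite -(ler_nat R) natrX => le.
set C := [set t in _ | _] in ge *; move: ge le (ler0n R #|C|) (ler0n R #|A|).
move: (#|A|%:R) (#|C|%:R) (#|` _|%:R) => n m D ge le m0 n0 lt.
have h1 : 0 <= 2 / e * (e / 2 * mu - (n - mu)) ^+ 2.
  by rewrite mulr_ge0 ?exprn_even_ge0 // divr_ge0 // ltW.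
have h2 : 0 <= 2 / e * (e / 2 * mu + (n - mu)) ^+ 2.
  by rewrite mulr_ge0 ?exprn_even_ge0 // divr_ge0 // ltW.
have E1 : 2 / e * (e / 2 * mu - (n - mu)) ^+ 2 =
  e / 2 * mu ^+ 2 - 2 * mu * (n - mu) + 2 / e * (n - mu) ^+ 2.
  by field; rewrite gt_eqF.
have E2 : 2 / e * (e / 2 * mu + (n - mu)) ^+ 2 =
  e / 2 * mu ^+ 2 + 2 * mu * (n - mu) + 2 / e * (n - mu) ^+ 2.
  by field; rewrite gt_eqF.
rewrite E1 in h1; rewrite E2 in h2.
have sq : n ^+ 2 = mu ^+ 2 + 2 * mu * (n - mu) + (n - mu) ^+ 2 by ring.
have s0 : 0 <= (n - mu) ^+ 2 by rewrite exprn_even_ge0.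
rewrite mulrDl mul1r in lt.
by apply/andP; split; lra.
Qed.

Lemma Ex_size_defect (q e : R) (N : nat) : 0 <= q <= 1 -> 0 < e ->
  Ex q (size_defect e (N%:R * q) (N := N)) <=
    (2 + 2 / e) * (N.+1%:R * q) +
    (N.+1%:R ^+ 3 * q ^+ 4 + 2 * N.+1%:R ^+ 2 * q ^+ 3).
Proof.
move=> q01 e0; have [q0 q1] := andP q01.
rewrite /size_defect 2!ExD ExZ Ex_card_deviation Ex_card.
have := Ex_collisions N u_neq0 v_neq0 uv q01.
have k0 : 0 <= 1 + 2 / e by rewrite addr_ge0 // divr_ge0 // ltW.
have s0 : 0 <= N%:R * q ^+ 2 by rewrite mulr_ge0 ?exprn_ge0.
have := mulr_ge0 k0 s0.
by lra.
Qed.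

Lemma prob_sim_subcritical (p : nat -> R) :
  (forall N, 0 < p N < 1) -> is_little_o (fun N => N%:R^-1) p ->
  p @ \oo --> (0 : R) -> is_little_o p (fun N => N%:R `^ (- 2^-1)) ->
  prob_sim p (fun N A => image_card R (linform u v) A)
    (fun N => (N%:R * p N) ^+ 2).
Proof.
move=> p01 pl pc lo e1 e2 e10 e20.
have p0 N : 0 < p N by have /andP[] := p01 N.
have pN : (fun N => N%:R * p N ^+ 2) @ \oo --> (0 : R).
  apply: cvg_trans (sqr_cvg0 lo); apply: near_eq_cvg; near=> N.
  by rewrite exprMn exprVn sqr_powR_half invrK mulrC.
pose B N := 2 / e1 * ((2 + 2 / e1) * 2 * (N%:R^-1 / p N) +
  8 * (N%:R * p N ^+ 2) + 8 * p N).
have Bc : B @ \oo --> (0 : R).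
  have -> : 0 = 2 / e1 * ((2 + 2 / e1) * 2 * 0 + 8 * 0 + 8 * 0) :> R by ring.
  apply: cvgM; first exact: cvg_cst.
  apply: cvgD; first apply: cvgD; apply: cvgM => //; exact: cvg_cst.
have : \forall N \near \oo, Pr (p N) [set A : {set 'I_N.+1} |
    image_card R (linform u v) A \notin
      `[(1 - e1) * (N%:R * p N) ^+ 2, (1 + e1) * (N%:R * p N) ^+ 2]] < e2.
  near=> N; have pN01 : 0 <= p N <= 1 by have /andP[/ltW -> /ltW ->] := p01 N.
  have N0 : (0 < N)%N by near: N; exact: nbhs_infty_gt.
  have NR0 : 0 < N%:R :> R by rewrite ltr0n.
  have t0 : 0 < e1 / 2 * (N%:R * p N) ^+ 2.
    by rewrite mulr_gt0 ?divr_gt0 // exprn_gt0 // mulr_gt0.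
  apply: le_lt_trans (markov_Pr pN01 t0
    (F := size_defect e1 (N%:R * p N) (N := N)) _ _) _.
  - by move=> A; exact: size_defect_ge0.
  - by move=> A; rewrite inE; exact: size_defect_large.
  apply: (@le_lt_trans _ _ (B N)); last by near: N; exact: cvg0_pos_lt.
  rewrite ler_pdivrMr //; apply: le_trans (Ex_size_defect _ pN01 e10) _.
  have -> : B N * (e1 / 2 * (N%:R * p N) ^+ 2) =
     (2 + 2 / e1) * (2 * N%:R * p N) +
     ((2 * N%:R) ^+ 3 * p N ^+ 4 + 2 * (2 * N%:R) ^+ 2 * p N ^+ 3).
    by rewrite /B; field; rewrite !gt_eqF.
  have N1 : N.+1%:R <= 2 * N%:R :> R by rewrite -natrM ler_nat; lia.
  have NX k : N.+1%:R ^+ k <= (2 * N%:R) ^+ k :> R.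
    by rewrite lerXn2r ?nnegrE ?mulr_ge0.
  have pX k : 0 <= p N ^+ k by rewrite exprn_ge0 // ltW.
  apply: lerD; last apply: lerD.
  - rewrite ler_wpM2l ?addr_ge0 ?divr_ge0 ?(ltW e10) //.
    by rewrite ler_wpM2r // ltW.
  - by rewrite ler_wpM2r.
  - by rewrite ler_wpM2r // ler_wpM2l.
case=> N0 _ hN0; exists N0.+1 => // N N0N; apply: hN0 => /=.
by apply: leq_trans N0N; apply: ltnW.
Unshelve. all: by end_near. Qed.

End SmallProbability.

Theorem theorem3p1 (R : realType) (p : nat -> R) (u v : int)
  (p01 : forall N : nat, 0 < p N < 1)
  (p_large : is_little_o (fun N => N%:R^-1) p)
  (p_small : is_little_o p (fun=> 1))
  (u_neq0 : u != 0) (v_neq0 : v != 0)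
  (v_le_u : `|v| <= u)
  (gcd_uv : gcdz u v = 1)
  (uv_neq11 : (u, v) != (1, 1)) :
  [/\ is_little_o p (fun N => N%:R `^ (- 2^-1)) ->
        prob_sim p (fun N A => image_card R (linform u v) A)
          (fun N => (N%:R * p N) ^+ 2),
      forall c : R, 0 < c ->
        (\forall N \near \oo, p N = c * N%:R `^ (- 2^-1)) ->
        (forall x : R, 0 < x -> 0 < g u v x < (u + `|v|)%:~R) /\
        prob_sim p (fun N A => image_card R (linform u v) A)
          (fun N => g u v (c ^+ 2 / u%:~R) * N%:R)
    & is_little_o (fun N => N%:R `^ (- 2^-1)) p ->
        prob_sim p (fun N A => image_cocard R u v A)
          (fun N => (2 * u * `|v|)%:~R / p N ^+ 2)].
Proof.
have u_gt0 : 0 < u by lia.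
have uv : u != v.
  apply: contra uv_neq11 => /eqP uvE; rewrite -uvE in gcd_uv *.
  by move: gcd_uv; rewrite gcdzz => ?; apply/eqP; congr (_, _); lia.
have pc : p @ \oo --> (0 : R).
  by apply: cvg_trans p_small; apply: near_eq_cvg; near=> N; rewrite divr1.
split.
- exact: prob_sim_subcritical.
- move=> c c0 pE; split=> [x|]; first exact: g_bounds.
  exact: prob_sim_critical.
- exact: prob_sim_supercritical.
Unshelve. all: by end_near. Qed.
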